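(* Let $n\geq 2$ and let $f\in R=\mathbb{C}[x_1,\dots,x_n]$ be homogeneous of degree $d$, with $\dim\operatorname{Sing} f^{-1}(0)\leq 1$ and $f$ not a polynomial of $n-1$ variables. Assume that the singular points of $Z=\{f=0\}\subset\mathbb{P}^{n-1}$ are ordinary double points $z_1,\dots,z_{\tau_Z}$ (with $\tau_Z\geq 1$), and moreover that the $z_i$ correspond to linearly independent vectors in $\mathbb{C}^n$ (so that $\tau_Z\leq n$). Then $$\mu''_k=\begin{cases}0&\text{if }k<n,\\1&\text{if }k=n,\\\tau_Z&\text{if }k>n,\end{cases}\qquad \nu_k=\begin{cases}0&\text{if }k<n(d-1),\\\tau_Z-1&\text{if }k=n(d-1),\\\tau_Z&\text{if }k>n(d-1),\end{cases}$$ $$\mu'_k=\begin{cases}0&\text{if }k\notin\bigl(n,n(d-1)\bigr),\\\gamma_k-\tau_Z&\text{if }k\in\bigl(n,n(d-1)\bigr),\end{cases}$$ where $\bigl(n,n(d-1)\bigr)\subset\mathbb{R}$ denotes an open interval.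
   Context: $R=\mathbb{C}[x_1,\dots,x_n]$ is graded by $\deg x_i=1$. $\Omega^j$ is the graded free $R$-module of algebraic differential $j$-forms on $\mathbb{C}^n$, with $\deg x_i=\deg dx_i=1$. $\operatorname{Sing} f^{-1}(0)\subset\mathbb{C}^n$ is the common zero set of the partial derivatives of $f$. ''$f$ is not a polynomial of $n-1$ variables'' means that no linear change of coordinates makes $f$ depend on only $n-1$ variables. $M:=\Omega^n/df\wedge\Omega^{n-1}$ and $N:=\operatorname{Ker}(df\wedge:\Omega^{n-1}\to\Omega^n)/df\wedge\Omega^{n-2}$, graded so that $M_k$ consists of classes of $n$-forms of degree $k$ and $N_k$ of classes of $(n-1)$-forms of degree $k-d$. With $\mathfrak{m}=(x_1,\dots,x_n)$, $M':=\{a\in M\mid \mathfrak{m}^ja=0 \text{ for } j\gg 0\}$ and $M'':=M/M'$. Set $\mu'_k:=\dim M'_k$, $\mu''_k:=\dim M''_k$, $\nu_k:=\dim N_k$ (over $\mathbb{C}$). The integers $\gamma_k$ are defined by $\sum_k\gamma_kt^k=(t^d-t)^n/(t-1)^n$. The total Tjurina number $\tau_Z$ is the sum over singular points $z$ of $Z$ of $\dim_{\mathbb{C}}\mathcal{O}_{\mathbb{P}^{n-1},z}/(h_z,\partial h_z)$ with $h_z$ a local equation of $Z$ at $z$; for ordinary double points (non-degenerate critical points of $h_z$) it is the number of singular points. *)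

(* Defs.v *)
From HB Require Import structures.
From mathcomp Require Import all_boot all_order all_algebra.
From mathcomp Require Import fraction.
From mathcomp Require Import complex mpoly.
From mathcomp Require Import reals.

Set Implicit Arguments.
Unset Strict Implicit.
Unset Printing Implicit Defensive.

Import Order.TTheory GRing.Theory Num.Theory.
Local Open Scope ring_scope.

(* [quot_dim A B m] : the image of the subspace A in V / B has dimension m;
   e represents a basis.  B need not be contained in A. *)
Definition quot_dim (K : fieldType) (V : lmodType K) (A B : V -> Prop)
    (m : nat) : Prop :=
  exists e : 'I_m -> V,
    [/\ forall i, A (e i),
        forall a, A a -> exists c : 'I_m -> K, B (a - \sum_i c i *: e i)
      & forall c : 'I_m -> K, B (\sum_i c i *: e i) -> forall i, c i = 0].

Section Forms.
Variables (K : fieldType) (n : nat).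

(* The exterior algebra of differential forms on K^n: the form w stands for
   the sum over S = {i1 < ... < ij} of w S * dx_i1 /\ ... /\ dx_ij. *)
Definition diff_form : Type := {ffun {set 'I_n} -> {mpoly K[n]}}.
HB.instance Definition _ := GRing.Lmodule.on diff_form.

Definition Omega (j : nat) (w : diff_form) : Prop :=
  forall S : {set 'I_n}, #|S| != j -> w S = 0.

(* deg x_i = deg dx_i = 1; the degree is an arbitrary integer. *)
Definition form_homog (k : int) (w : diff_form) : Prop :=
  forall (S : {set 'I_n}) (m : 'X_{1..n}),
    m \in msupp (w S) -> (mdeg m + #|S|)%N%:Z = k.

(* Number of transpositions sorting dx_A /\ dx_B. *)
Definition inversions (A B : {set 'I_n}) : nat :=
  #|[set p : 'I_n * 'I_n | [&& p.1 \in A, p.2 \in B & (p.2 < p.1)%N]]|.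

Definition wedge (u v : diff_form) : diff_form :=
  [ffun S : {set 'I_n} => \sum_(A : {set 'I_n} | A \subset S)
     (-1) ^+ inversions A (S :\: A) * (u A * v (S :\: A))].

Definition fmul (g : {mpoly K[n]}) (w : diff_form) : diff_form :=
  [ffun S : {set 'I_n} => g * w S].

Definition dx (i : 'I_n) : diff_form :=
  [ffun S : {set 'I_n} => (S == [set i])%:R].

Definition total_diff (f : {mpoly K[n]}) : diff_form :=
  \sum_i fmul f^`M(i) (dx i).

Definition df_Omega (f : {mpoly K[n]}) (j : nat) (w : diff_form) : Prop :=
  exists2 v : diff_form, Omega j v & w = wedge (total_diff f) v.

Definition irrelevant (g : {mpoly K[n]}) : Prop :=
  exists c : 'I_n -> {mpoly K[n]}, g = \sum_i c i * 'X_i.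

(* The n-forms whose class in M = Omega^n / df /\ Omega^(n-1) lies in M'.
   The ideal m^j is generated by the products of j elements of m. *)
Definition M_torsion (f : {mpoly K[n]}) (w : diff_form) : Prop :=
  Omega n w /\
  exists j0 : nat, forall j : nat, (j0 <= j)%N ->
    forall g : 'I_j -> {mpoly K[n]}, (forall i, irrelevant (g i)) ->
      df_Omega f n.-1 (fmul (\prod_i g i) w).

Definition dim_M' (f : {mpoly K[n]}) (k : int) (m : nat) : Prop :=
  quot_dim (fun w : diff_form => M_torsion f w /\ form_homog k w)
           (df_Omega f n.-1) m.

(* M'' = M / M' is Omega^n modulo the preimage of M'. *)
Definition dim_M'' (f : {mpoly K[n]}) (k : int) (m : nat) : Prop :=
  quot_dim (fun w : diff_form => Omega n w /\ form_homog k w)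
           (M_torsion f) m.

(* d is the degree of f, which enters the grading of N. *)
Definition dim_N (d : nat) (f : {mpoly K[n]}) (k : int) (m : nat) : Prop :=
  quot_dim (fun w : diff_form => [/\ Omega n.-1 w, wedge (total_diff f) w = 0
                              & form_homog (k - d%:Z) w])
           (df_Omega f n.-2) m.

End Forms.

(* (t^d - t)^n / (t - 1)^n is a polynomial; the divisor is monic, so the
   division below is the exact one. *)
Definition gamma_poly (n d : nat) : {poly int} :=
  ('X^d - 'X) ^+ n %/ ('X - 1) ^+ n.

Definition gamma (n d : nat) (k : int) : int :=
  if k is Posz j then (gamma_poly n d)`_j else 0.

Section AffineSets.
Variables (K : fieldType) (n : nat).

Definition ev (v : 'rV[K]_n) (p : {mpoly K[n]}) : K := p.@[fun i => v 0 i].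

Definition zclosed (X : 'rV[K]_n -> Prop) : Prop :=
  exists P : {mpoly K[n]} -> Prop,
    forall v, X v <-> (forall p, P p -> ev v p = 0).

Definition zsub (X Y : 'rV[K]_n -> Prop) : Prop := forall v, X v -> Y v.

Definition zirreducible (X : 'rV[K]_n -> Prop) : Prop :=
  (exists v, X v) /\
  forall A B : 'rV[K]_n -> Prop, zclosed A -> zclosed B ->
    (forall v, X v -> A v \/ B v) -> zsub X A \/ zsub X B.

(* Krull dimension: every chain W_0 < ... < W_l of irreducible closed
   subsets of X has length l <= m. *)
Definition zdim_le (X : 'rV[K]_n -> Prop) (m : nat) : Prop :=
  forall (l : nat) (W : nat -> 'rV[K]_n -> Prop),
    (forall i, (i <= l)%N ->
       [/\ zclosed (W i), zirreducible (W i) & zsub (W i) X]) ->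
    (forall i, (i < l)%N -> zsub (W i) (W i.+1) /\ ~ zsub (W i.+1) (W i)) ->
    (l <= m)%N.

Definition Sing (f : {mpoly K[n]}) (v : 'rV[K]_n) : Prop :=
  forall i : 'I_n, ev v f^`M(i) = 0.

Definition lin_change (A : 'M[K]_n) (f : {mpoly K[n]}) : {mpoly K[n]} :=
  f \mPo [tuple \sum_j A i j *: 'X_j | i < n].

Definition poly_of_fewer_variables (f : {mpoly K[n]}) : Prop :=
  exists2 A : 'M[K]_n, A \in unitmx &
  exists i : 'I_n, forall m, m \in msupp (lin_change A f) -> m i = 0%N.

End AffineSets.

(* Rational functions, as a vector space over the ground field. *)
Definition ratfun (K : fieldType) (m : nat) : Type := {fraction {mpoly K[m]}}.

Section RationalFunctions.
Variables (K : fieldType) (m : nat).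

HB.instance Definition _ := GRing.Field.on (ratfun K m).

Definition rf (p : {mpoly K[m]}) : ratfun K m := tofrac p.

Definition rf_scale (c : K) (x : ratfun K m) : ratfun K m := rf c%:MP * x.

Fact rf_scaleA (a b : K) (x : ratfun K m) :
  rf_scale a (rf_scale b x) = rf_scale (a * b) x.
Proof. by rewrite /rf_scale /rf mulrA mpolyCM rmorphM. Qed.

Fact rf_scale1 : left_id 1 rf_scale.
Proof. by move=> x; rewrite /rf_scale /rf mpolyC1 rmorph1 mul1r. Qed.

Fact rf_scaleDr : right_distributive rf_scale +%R.
Proof. by move=> a x y; rewrite /rf_scale mulrDr. Qed.

Fact rf_scaleDl (x : ratfun K m) : {morph rf_scale^~ x : a b / a + b}.
Proof. by move=> a b; rewrite /rf_scale /rf mpolyCD rmorphD mulrDl. Qed.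

HB.instance Definition _ := GRing.Zmodule_isLmodule.Build K (ratfun K m)
  rf_scaleA rf_scale1 rf_scaleDr rf_scaleDl.

Definition local_ring (p : 'rV[K]_m) (x : ratfun K m) : Prop :=
  exists a b : {mpoly K[m]}, ev p b != 0 /\ x = rf a / rf b.

(* The ideal (h, dh) of the local ring at p. *)
Definition tjurina_ideal (h : {mpoly K[m]}) (p : 'rV[K]_m) (x : ratfun K m)
    : Prop :=
  exists (c0 : ratfun K m) (c : 'I_m -> ratfun K m),
    [/\ local_ring p c0, forall i, local_ring p (c i)
      & x = c0 * rf h + \sum_i c i * rf h^`M(i)].

Definition nondeg_crit (h : {mpoly K[m]}) (p : 'rV[K]_m) : Prop :=
  (forall i : 'I_m, ev p h^`M(i) = 0) /\
  \matrix_(i < m, j < m) ev p h^`M(i)^`M(j) \in unitmx.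

End RationalFunctions.

Section Projective.
Variables (K : fieldType) (n : nat).

(* Points of P^(n-1) are given by nonzero vectors.  In the standard chart
   x_i <> 0, with coordinates x_j / x_i (j <> i), the hypersurface f = 0 has
   the equation [dehom i f] and the point v the coordinates [chart_pt i v]. *)
Definition dehom (i : 'I_n) (f : {mpoly K[n]}) : {mpoly K[n.-1]} :=
  f \mPo [tuple (if unlift i j is Some k then 'X_k else 1) | j < n].

Definition chart_pt (i : 'I_n) (v : 'rV[K]_n) : 'rV[K]_n.-1 :=
  \row_k (v 0 (lift i k) / v 0 i).

Definition proj_sing (f : {mpoly K[n]}) (v : 'rV[K]_n) : Prop :=
  [/\ v != 0, ev v f = 0 & Sing f v].

(* z_1, ..., z_s are representatives of the singular points of f = 0 in
   P^(n-1), each point occurring exactly once. *)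
Definition sing_points (f : {mpoly K[n]}) (s : nat) (z : 'I_s -> 'rV[K]_n)
    : Prop :=
  [/\ forall i, proj_sing f (z i),
      forall i j (c : K), z i = c *: z j -> i = j
    & forall v, proj_sing f v -> exists i (c : K), v = c *: z i].

Definition ordinary_double_point (f : {mpoly K[n]}) (v : 'rV[K]_n) : Prop :=
  forall i : 'I_n, v 0 i != 0 ->
    ev (chart_pt i v) (dehom i f) = 0 /\
    nondeg_crit (dehom i f) (chart_pt i v).

Definition tjurina_number (f : {mpoly K[n]}) (v : 'rV[K]_n) (t : nat) : Prop :=
  forall i : 'I_n, v 0 i != 0 ->
    quot_dim (local_ring (chart_pt i v))
             (tjurina_ideal (dehom i f) (chart_pt i v)) t.

Definition total_tjurina (f : {mpoly K[n]}) (tau : nat) : Prop :=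
  exists (s : nat) (z : 'I_s -> 'rV[K]_n) (t : 'I_s -> nat),
    [/\ sing_points f z, forall i, tjurina_number f (z i) (t i)
      & tau = (\sum_i t i)%N].

End Projective.

(* Main.v *)
Require Import Defs.
From mathcomp Require Import all_boot all_order all_algebra.
From mathcomp Require Import fraction.
From mathcomp Require Import complex mpoly.
From mathcomp Require Import reals.
From mathcomp Require boolp.
From mathcomp Require Import ring zify.

(** Write R for the polynomial ring, e = d - 1, f_1, ..., f_n for the partial
    derivatives of f and J for the ideal they generate. Let l be a linear form
    with value 1 at all the (linearly independent) nodes z_1, ..., z_s.

    Complete intersection. On the hyperplane l = 0 the f_i have no common zero
    outside the origin, since every singular point is a multiple of some z_i.
    So n - 1 generic linear combinations of the f_i form, together with l, a
    regular sequence ([ci_generic]). Starting from the variables, one variable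
    at a time is exchanged for such a combination. Regularity, the Hilbert
    function and the degree of the socle of the quotient can be followed through
    each exchange ([ci_exch]); the new member is regular because it does not
    vanish at the finitely many points cut out by the others, which is proved
    with joint eigenvectors of the variables on finite dimensional quotients
    ([point_of_quot]). Let G be the ideal of the n - 1 combinations, g one more
    combination with J = G + (g), and A = R/G. Then l is regular on A, and A/lA
    has Hilbert series (1 + t + ... + t^(e-1))^(n-1); its socle lies in the top
    degree T = (n-1)(e-1), in which A/lA has dimension 1.

    Nodes. At z_i the Hessian matrix of f has kernel the line of z_i, so the f_j
    and l - 1 generate the maximal ideal of the local ring at z_i
    ([local_maximal_ideal]); for the same reason, in the charts, the Tjurina numbers
    are 1 ([tjurina_nondeg]). It follows that J + (l - 1) is the ideal of all
    polynomials vanishing at the z_i ([reduced_points]). A form is therefore torsion modulo J if and only if it vanishes at the nodes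
    ([at_nodesP]). Thus M'' in polynomial degree j has the dimension of the
    space of value vectors at the nodes of forms of degree j: 1 for j = 0, and s
    for j > 0 as the z_i are independent.

    Syzygies. The first homology of the Koszul complex of a regular sequence
    vanishes, so N is the annihilator of g in A ([dim_N_nodal]). In degrees
    j >= T one may put l = 1: A becomes a finite dimensional algebra C, and the
    annihilator of g in C has the dimension of C/gC, which is s. In degrees
    below T, an element of A supported at a single node is zero: after division
    by the largest possible power of l it would give a socle element of A/lA in
    degree less than T ([single_node]). Multiplying by the linear forms dual to
    the z_i, one concludes that the annihilator vanishes in degrees j < T - 1,
    and that it has dimension s - 1 for j = T - 1 ([quot_dim_koszul]).

    Torsion. The exact sequence 0 -> N -> A -> A -> R/J -> 0, whose middle map is
    multiplication by g, gives the dimension of R/J as the coefficient of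
    (1 + t + ... + t^(e-1))^n, which up to the factor t^n is the series of gamma,
    plus a dimension of N; subtracting M'' leaves that of M'
    ([torsion_dim_value]). *)

Set Implicit Arguments.
Unset Strict Implicit.
Unset Printing Implicit Defensive.

Import Order.TTheory GRing.Theory Num.Theory.
Local Open Scope ring_scope.

(** * Dimensions of quotients of subspaces *)

Section QuotDim.
Variable K : fieldType.
Implicit Types V W : lmodType K.

Definition subspace V (A : V -> Prop) : Prop :=
  A 0 /\ forall c x y, A x -> A y -> A (c *: x + y).

Lemma subspace_add V (A : V -> Prop) x y : subspace A -> A x -> A y -> A (x + y).
Proof. by move=> [_ sA] Ax Ay; rewrite -[x]scale1r; apply: sA. Qed.

Lemma subspace_scale V (A : V -> Prop) c x : subspace A -> A x -> A (c *: x).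
Proof. by move=> [A0 sA] Ax; rewrite -[_ *: _]addr0; apply: sA. Qed.

Lemma subspace_opp V (A : V -> Prop) x : subspace A -> A x -> A (- x).
Proof. by move=> sA Ax; rewrite -scaleN1r; apply: subspace_scale. Qed.

Lemma subspace_sub V (A : V -> Prop) x y : subspace A -> A x -> A y -> A (x - y).
Proof. by move=> sA Ax Ay; apply: subspace_add => //; apply: subspace_opp. Qed.

Lemma subspace_sum V (A : V -> Prop) (I : finType) (P : pred I) (F : I -> V) :
  subspace A -> (forall i, P i -> A (F i)) -> A (\sum_(i | P i) F i).
Proof.
move=> sA AF; elim/big_rec: _ => [|i x Pi Ax]; first by case: sA.
by apply: subspace_add => //; apply: AF.
Qed.

Lemma subspace_comb V (A : V -> Prop) m (c : 'I_m -> K) (e : 'I_m -> V) :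
  subspace A -> (forall i, A (e i)) -> A (\sum_i c i *: e i).
Proof. by move=> sA Ae; apply: subspace_sum => // i _; apply: subspace_scale. Qed.

Lemma linear_comb V W (phi : V -> W) m (c : 'I_m -> K) (e : 'I_m -> V) :
  linear phi -> phi (\sum_i c i *: e i) = \sum_i c i *: phi (e i).
Proof.
move=> lin; have phi0 : phi 0 = 0.
  by have := lin (- 1) 0 0; rewrite scaleN1r oppr0 addr0 scaleN1r addNr.
elim/big_rec2: _ => // i y x _ <-; exact: lin.
Qed.

Lemma linear_opp V W (phi : V -> W) x y : linear phi -> phi (x - y) = phi x - phi y.
Proof. by move=> lin; rewrite addrC -scaleN1r lin scaleN1r addrC. Qed.

Definition indep_mod V (A B : V -> Prop) m (e : 'I_m -> V) : Prop :=
  (forall i, A (e i)) /\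
  forall c : 'I_m -> K, B (\sum_i c i *: e i) -> forall i, c i = 0.

(** A longer independent family would be killed, modulo B, by a nonzero vector
    of the left kernel of its coordinate matrix. *)
Lemma indep_mod_le V (A B : V -> Prop) m m' (e : 'I_m -> V) :
  subspace B -> quot_dim A B m' -> indep_mod A B e -> (m <= m')%N.
Proof.
move=> sB [e' [Ae' gen _]] [Ae ind]; rewrite leqNgt; apply/negP => lt_m'm.
have /fin_all_exists[c cE] i := gen _ (Ae i).
pose M := \matrix_(i < m, j < m') c i j.
have: kermx M != 0.
  rewrite -mxrank_eq0 mxrank_ker subn_eq0 -ltnNge.
  exact: leq_ltn_trans (rank_leq_col _) lt_m'm.
case/rowV0Pn => v /sub_kermxP vM0 /eqP[]; apply/rowP => i; rewrite mxE.
apply: (ind (fun i => v 0 i)) => //.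
have -> : \sum_i v 0 i *: e i =
          \sum_i v 0 i *: (e i - \sum_j c i j *: e' j).
  rewrite [RHS](eq_bigr (fun i => v 0 i *: e i - \sum_j (v 0 i * M i j) *: e' j)).
    rewrite sumrB [X in _ - X]exchange_big /= [X in _ - X]big1 ?subr0 // => j _.
    rewrite -scaler_suml; have /rowP/(_ j) := vM0.
    by rewrite !mxE => ->; rewrite scale0r.
  move=> k _; rewrite scalerBr scaler_sumr; congr (_ - _).
  by apply: eq_bigr => j _; rewrite scalerA mxE.
exact: subspace_comb.
Qed.

Lemma quot_dim_uniq V (A B : V -> Prop) m m' :
  subspace B -> quot_dim A B m -> quot_dim A B m' -> m = m'.
Proof.
move=> sB q q'; apply/eqP; rewrite eqn_leq.
case: (q) (q') => e [? ? ?] [e' [? ? ?]].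
by rewrite (indep_mod_le (e := e) sB q') // (indep_mod_le (e := e') sB q).
Qed.

Lemma quot_dim_indep_bound V (A B : V -> Prop) N :
  subspace B -> (forall m (e : 'I_m -> V), indep_mod A B e -> (m <= N)%N) ->
  exists m, quot_dim A B m.
Proof.
move=> sB bound.
pose P m := boolp.asbool (exists e : 'I_m -> V, indep_mod A B e).
have P0 : exists m, P m.
  exists 0%N; apply/boolp.asboolP; exists (fun=> 0); split=> [[]//|c _ []//].
have Pb m : P m -> (m <= N)%N by move/boolp.asboolP => [e]; apply: bound.
case: (ex_maxnP P0 Pb) => m /boolp.asboolP[e [Ae ind]] maxm.
exists m, e; split=> // a Aa.
case: (boolp.EM (exists c : 'I_m -> K, B (a - \sum_i c i *: e i))) => // noc.
(* otherwise a could be added to the maximal family e *)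
suff: P m.+1 by move/maxm; rewrite ltnn.
apply/boolp.asboolP.
exists (fun i => if unlift ord0 i is Some j then e j else a).
split=> [i|c]; first by case: unliftP.
rewrite big_ord_recl unlift_none.
under eq_bigr do rewrite liftK.
move=> Bc.
have c0 : c ord0 = 0.
  apply/eqP/negP => /negP c0; apply: noc.
  exists (fun i => - ((c ord0)^-1 * c (lift ord0 i))).
  have -> : a - \sum_i - ((c ord0)^-1 * c (lift ord0 i)) *: e i =
     (c ord0)^-1 *: (c ord0 *: a + \sum_i c (lift ord0 i) *: e i).
    rewrite scalerDr scalerA mulVf // scale1r; congr (_ + _).
    rewrite -sumrN scaler_sumr; apply: eq_bigr => i _.
    by rewrite scaleNr opprK scalerA.
  exact: subspace_scale.
move: Bc; rewrite c0 scale0r add0r => /ind ce i.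
by case: (unliftP ord0 i) => [j|] ->.
Qed.

Lemma quot_dim_add V (A B C : V -> Prop) m m' :
  subspace A -> subspace B ->
  (forall x, B x -> A x) -> (forall x, A x -> C x -> B x) ->
  quot_dim A B m -> quot_dim B C m' -> quot_dim A C (m + m').
Proof.
move=> sA sB BA CB [e [Ae gen ind]] [e' [Be' gen' ind']].
pose g i := match split i with inl j => e j | inr j => e' j end.
have gE (c : 'I_(m + m') -> K) : \sum_i c i *: g i =
    \sum_i c (lshift m' i) *: e i + \sum_j c (rshift m j) *: e' j.
  rewrite big_split_ord; congr (_ + _); apply: eq_bigr => i _; congr (_ *: _).
    by rewrite /g (unsplitK (inl i : 'I_m + 'I_m')).
  by rewrite /g (unsplitK (inr i : 'I_m + 'I_m')).
have Ag i : A (g i) by rewrite /g; case: split => j; [apply: Ae | apply/BA/Be'].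
exists g; split=> // [a Aa|c Cc].
- have [c Bc] := gen a Aa; have [c' Cc'] := gen' _ Bc.
  exists (fun i => match split i with inl j => c j | inr j => c' j end).
  rewrite gE (eq_bigr (fun i => c i *: e i)); last first.
    by move=> i _; rewrite (unsplitK (inl i : 'I_m + 'I_m')).
  rewrite [X in _ - (_ + X)](eq_bigr (fun i => c' i *: e' i)) ?opprD ?addrA //.
  by move=> i _; rewrite (unsplitK (inr i : 'I_m + 'I_m')).
- have {}Bc : B (\sum_i c i *: g i) by apply: CB => //; apply: subspace_comb.
  have c1 : forall i, c (lshift m' i) = 0.
    apply: (ind (fun i => c (lshift m' i))).
    rewrite -[X in B X](addrK (\sum_j c (rshift m j) *: e' j)) -gE.
    by apply: subspace_sub => //; apply: subspace_comb.
  rewrite gE big1 ?add0r in Cc; last by move=> i _; rewrite c1 scale0r.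
  have c2 := ind' (fun i => c (rshift m i)) Cc.
  by move=> i; rewrite -(splitK i); case: split => j /=.
Qed.

(** Independent families of A modulo B, and of B modulo C, are independent in A
    modulo C; hence their lengths are bounded, and the dimensions exist. *)
Lemma quot_dim_split V (A B C : V -> Prop) m :
  subspace A -> subspace B -> subspace C ->
  (forall x, B x -> A x) -> (forall x, A x -> C x -> B x) ->
  quot_dim A C m ->
  exists m1 m2, [/\ quot_dim A B m1, quot_dim B C m2 & m = (m1 + m2)%N].
Proof.
move=> sA sB sC BA CB qAC.
have [m1 q1] : exists m1, quot_dim A B m1.
  apply: (quot_dim_indep_bound (N := m)) => // k e [Ae ind].
  apply: (indep_mod_le sC qAC (e := e)); split=> // c Cc; apply: ind.
  by apply: CB => //; apply: subspace_comb.
have [m2 q2] : exists m2, quot_dim B C m2.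
  apply: (quot_dim_indep_bound (N := m)) => // k e [Be ind].
  by apply: (indep_mod_le sC qAC (e := e)); split=> // i; apply: BA.
exists m1, m2; split=> //.
exact: quot_dim_uniq qAC (quot_dim_add sA sB BA CB q1 q2).
Qed.

(** If phi induces an isomorphism of A / B onto A' / B', dimensions can be
    transported in both directions. *)
Section Transport.
Variables (V W : lmodType K) (phi : V -> W) (lin : linear phi).
Variables (A B : V -> Prop) (A' B' : W -> Prop).
Hypotheses (sA : subspace A) (sB' : subspace B').
Hypothesis phiA : forall a, A a -> A' (phi a).
Hypothesis phiB : forall a, A a -> (B a <-> B' (phi a)).
Hypothesis phi_onto : forall a', A' a' -> exists2 a, A a & B' (a' - phi a).

Lemma quot_dim_map m : quot_dim A B m -> quot_dim A' B' m.
Proof.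
case=> e [Ae gen ind]; exists (phi \o e); split=> [i|a' /phi_onto[a Aa Ba]|c].
- exact/phiA/Ae.
- have [c Bc] := gen a Aa; exists c.
  rewrite -linear_comb // -[a'](subrK (phi a)) -addrA -linear_opp //.
  apply: subspace_add => //; apply/phiB => //.
  by apply: subspace_sub => //; apply: subspace_comb.
- rewrite -linear_comb // => Bc; apply: ind; apply/phiB => //.
  exact: subspace_comb.
Qed.

Lemma quot_dim_comap m : quot_dim A' B' m -> quot_dim A B m.
Proof.
case=> e' [Ae' gen ind].
have /fin_all_exists2[e Ae eE] i := phi_onto (Ae' i).
have eqB (c : 'I_m -> K) :
    B' (\sum_i c i *: e' i - phi (\sum_i c i *: e i)).
  rewrite linear_comb // -sumrB.
  rewrite (eq_bigr (fun i => c i *: (e' i - phi (e i)))); last first.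
    by move=> i _; rewrite scalerBr.
  exact: subspace_comb.
exists e; split=> // [a Aa|c Bc].
- have [c Bc] := gen _ (phiA Aa); exists c; apply/phiB.
    by apply: subspace_sub => //; apply: subspace_comb.
  rewrite linear_opp // -(subrK (\sum_i c i *: e' i) (phi a)) -addrA.
  exact: subspace_add.
- apply: ind; rewrite -(subrK (phi (\sum_i c i *: e i)) (\sum_i c i *: e' i)).
  by apply: subspace_add => //; apply/phiB => //; apply: subspace_comb.
Qed.

End Transport.

Lemma quot_dim_eq V (A A' B B' : V -> Prop) m :
  subspace A -> (forall a, A a <-> A' a) -> (forall a, A a -> (B a <-> B' a)) ->
  quot_dim A B m -> quot_dim A' B' m.
Proof.
move=> sA AA BB [e [Ae gen ind]]; exists e; split=> [i|a /AA Aa|c B'c].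
- exact/AA.
- have [c Bc] := gen a Aa; exists c; apply/BB => //.
  by apply: subspace_sub => //; apply: subspace_comb.
- by apply: ind; apply/BB => //; apply: subspace_comb.
Qed.

Lemma quot_dim0 V (A B : V -> Prop) :
  quot_dim A B 0 <-> forall a, A a -> B a.
Proof.
split=> [[e [_ gen _]] a /gen[c]|AB]; first by rewrite big_ord0 subr0.
exists (fun=> 0); split=> [[]//|a /AB Ba|c _ []//].
by exists (fun=> 0); rewrite big_ord0 subr0.
Qed.

End QuotDim.

(** * Homogeneous ideals of a polynomial ring *)

Notation hpart := (pihomog mdeg).

Section Ideals.
Variables (K : fieldType) (n : nat).
Local Notation R := {mpoly K[n]}.
Implicit Types (I : R -> Prop) (a b c v w : R).

Definition homog_of (j : nat) (a : R) : Prop := a \is j.-homog.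

Lemma subspace_homog_of j : subspace (homog_of j).
Proof.
split=> [|c x y hx hy]; first exact: rpred0.
by rewrite /homog_of rpredD ?rpredZ.
Qed.

Lemma hpartM j e a w : w \is e.-homog ->
  hpart j (a * w) = if (e <= j)%N then hpart (j - e) a * w else 0.
Proof.
move=> hw; rewrite {1}(pihomog_partitionE (mf := mdeg) (leqnn (msize a))).
rewrite mulr_suml raddf_sum /=.
have hk k : hpart j (hpart k a * w) =
            if (k + e == j)%N then hpart k a * w else 0.
  have h : hpart k a * w \is (k + e).-homog by rewrite dhomogM ?pihomogP.
  by case: eqP => [<-|/eqP ne]; [rewrite pihomog_dE | rewrite (pihomog_ne0 ne)].
under eq_bigr do rewrite hk.
rewrite -big_mkcond /=; case: leqP => [le_ej|lt_je]; last first.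
  by rewrite big1 // => k /eqP kE; lia.
rewrite -mulr_suml; congr (_ * w).
case: (ltnP (j - e) (msize a)) => [lt_j|le_j].
  by rewrite (big_pred1 (Ordinal lt_j)) // => k; rewrite /= -val_eqE /=; lia.
rewrite big_pred0; last by move=> k; have := ltn_ord k; lia.
rewrite pihomogE big_seq_cond big1 // => m /andP[/msize_mdeg_lt lt_m /eqP mE].
by rewrite mE ltnNge le_j in lt_m.
Qed.

Lemma hpart_sum a : exists k, a = \sum_(j < k) hpart j a.
Proof. by exists (msize a); apply: pihomog_partitionE. Qed.

Lemma homog_ind (P : R -> Prop) :
  P 0 -> (forall x y, P x -> P y -> P (x + y)) ->
  (forall j x, x \is j.-homog -> P x) -> forall x, P x.
Proof.
move=> P0 PD Ph x; have [k ->] := hpart_sum x.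
by elim/big_rec: _ => // j y _; apply: PD; apply: (Ph j); apply: pihomogP.
Qed.

Definition ideal I : Prop :=
  [/\ I 0, forall x y, I x -> I y -> I (x + y) & forall c x, I x -> I (c * x)].

Definition homog_ideal I : Prop := ideal I /\ forall j a, I a -> I (hpart j a).

Section IdealTheory.
Variable (I : R -> Prop) (idI : ideal I).

Lemma ideal0 : I 0. Proof. by case: idI. Qed.
Lemma idealD x y : I x -> I y -> I (x + y). Proof. by case: idI => _ + _; apply. Qed.
Lemma idealM c x : I x -> I (c * x). Proof. by case: idI => _ _; apply. Qed.
Lemma idealMr c x : I x -> I (x * c). Proof. by rewrite mulrC; apply: idealM. Qed.
Lemma idealN x : I x -> I (- x). Proof. by rewrite -mulN1r; apply: idealM. Qed.
Lemma idealB x y : I x -> I y -> I (x - y).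
Proof. by move=> Ix Iy; apply: idealD => //; apply: idealN. Qed.
Lemma idealZ (k : K) x : I x -> I (k *: x).
Proof. by rewrite -mul_mpolyC; apply: idealM. Qed.
Lemma ideal_sum (T : finType) (P : pred T) (F : T -> R) :
  (forall i, P i -> I (F i)) -> I (\sum_(i | P i) F i).
Proof.
move=> IF; elim/big_rec: _ => [|i x Pi Ix]; first exact: ideal0.
by apply: idealD => //; apply: IF.
Qed.
Lemma ideal_eqmod x y : I (x - y) -> I x <-> I y.
Proof.
move=> Ixy; split=> h; last by rewrite -(subrK y x); apply: idealD.
have -> : y = x - (x - y) by ring.
exact: idealB.
Qed.

Lemma subspace_ideal : subspace I.
Proof.
split=> [|c x y Ix Iy]; first exact: ideal0.
by apply: idealD => //; apply: idealZ.
Qed.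
End IdealTheory.

Definition adjoin I v : R -> Prop := fun a => exists b, I (a - b * v).

Lemma ideal_adjoin I v : ideal I -> ideal (adjoin I v).
Proof.
move=> idI; split=> [|x y [b Ib] [c Ic]|c x [b Ib]].
- by exists 0; rewrite mul0r subr0; apply: ideal0.
- exists (b + c); rewrite mulrDl opprD addrACA; exact: idealD.
- by exists (c * b); rewrite -mulrA -mulrBr; apply: idealM.
Qed.

Lemma adjoinS I v a : I a -> adjoin I v a.
Proof. by exists 0; rewrite mul0r subr0. Qed.

Lemma adjoinv I v b : ideal I -> adjoin I v (b * v).
Proof. by exists b; rewrite subrr; apply: ideal0. Qed.

Lemma homog_ideal_adjoin I v e :
  homog_ideal I -> v \is e.-homog -> homog_ideal (adjoin I v).
Proof.
move=> [idI hI] hv; split=> [|j a [b Ib]]; first exact: ideal_adjoin.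
have := hI j _ Ib; rewrite linearB /= (hpartM _ _ hv).
case: ifP => _ h; first by exists (hpart (j - e) b).
by exists 0; rewrite mul0r.
Qed.

Lemma adjoin_homog I v e j a :
  homog_ideal I -> v \is e.-homog -> a \is j.-homog -> adjoin I v a ->
  I a \/ exists2 b, (e <= j)%N /\ b \is (j - e).-homog & I (a - b * v).
Proof.
move=> [idI hI] hv ha [b Ib].
have := hI j _ Ib; rewrite linearB /= (hpartM _ _ hv) (pihomog_dE ha).
case: ifP => le_ej h; last by left; rewrite -[a]subr0.
by right; exists (hpart (j - e) b); rewrite ?pihomogP.
Qed.

Definition nzd I v : Prop := forall a, I (v * a) -> I a.

Lemma nzd_homog I v e : homog_ideal I -> v \is e.-homog ->
  (forall j a, a \is j.-homog -> I (v * a) -> I a) -> nzd I v.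
Proof.
move=> [idI hI] hv nz a Iva; have [k ->] := hpart_sum a.
apply: ideal_sum => // j _; apply: (nz j); first exact: pihomogP.
by have := hI (j + e)%N _ Iva; rewrite mulrC (hpartM _ _ hv) leq_addl addnK mulrC.
Qed.

(** If b c lies in I, then c = a c' modulo I because b is regular modulo I + (a);
    c' satisfies the same hypothesis, in lower degree. *)
Lemma nzd_swap1 I a b e e' : homog_ideal I ->
  a \is e.-homog -> (0 < e)%N -> b \is e'.-homog ->
  nzd I a -> nzd (adjoin I a) b -> nzd I b.
Proof.
move=> hI ha e0 hb nza nzb; apply: (nzd_homog hI hb) => j.
have idI : ideal I by case: hI.
elim/ltn_ind: j => j IH c hc Ibc.
have := nzb _ (adjoinS a Ibc).
case/(adjoin_homog hI ha hc) => // -[c' [le_ej hc'] Icc'].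
apply/(ideal_eqmod idI Icc'); apply: idealMr => //.
apply: (IH (j - e)%N) => //; first by lia.
apply: nza; have -> : a * (b * c') = b * c - b * (c - c' * a) by ring.
by apply: idealB => //; apply: idealM.
Qed.

Lemma nzd_swap2 I a b : ideal I ->
  nzd I a -> nzd (adjoin I a) b -> nzd (adjoin I b) a.
Proof.
move=> idI nza nzb c [x Ix].
have [|y Iy] := nzb x.
  exists c; rewrite -opprB; apply: idealN => //.
  by rewrite (mulrC c) (mulrC b).
exists y; apply: nza.
have -> : a * (c - y * b) = (a * c - x * b) + (x - y * a) * b by ring.
by apply: idealD => //; apply: idealMr.
Qed.

(** ** Ideals generated by part of a family *)

Implicit Types (u : 'I_n -> R) (T : {set 'I_n}).

Definition gen u T : R -> Prop :=
  fun a => exists c : 'I_n -> R, a = \sum_(i in T) c i * u i.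

Lemma ideal_gen u T : ideal (gen u T).
Proof.
split=> [|x y [b ->] [c ->]|c x [b ->]].
- by exists (fun=> 0); rewrite big1 // => i _; rewrite mul0r.
- exists (fun i => b i + c i); rewrite -big_split; apply: eq_bigr => i _.
  by rewrite mulrDl.
- by exists (fun i => c * b i); rewrite mulr_sumr; apply: eq_bigr => i _; rewrite mulrA.
Qed.

Lemma gen_mem u T i : i \in T -> gen u T (u i).
Proof.
move=> iT; exists (fun k => (k == i)%:R).
rewrite (bigD1 i) //= eqxx mul1r big1 ?addr0 // => k /andP[_ /negPf ->].
by rewrite mul0r.
Qed.

Lemma gen_sub u T I : ideal I -> (forall i, i \in T -> I (u i)) ->
  forall a, gen u T a -> I a.
Proof.
by move=> idI h a [c ->]; apply: ideal_sum => // i iT; apply: idealM => //; apply: h.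
Qed.

Lemma genU1 u T i a : i \notin T -> gen u (i |: T) a <-> adjoin (gen u T) (u i) a.
Proof.
move=> iT; split=> [[c ->]|[b [c cE]]].
  by exists (c i); rewrite big_setU1 //= addrAC subrr add0r; exists c.
rewrite -(subrK (b * u i) a) cE.
exists (fun k => if k == i then b else c k).
rewrite big_setU1 //= eqxx addrC; congr (_ + _); apply: eq_bigr => k kT.
by case: eqP kT iT => // -> ->.
Qed.

Lemma homog_ideal_gen u T (dg : 'I_n -> nat) :
  (forall i, u i \is (dg i).-homog) -> homog_ideal (gen u T).
Proof.
move=> hu; split=> [|j a [c ->]]; first exact: ideal_gen.
rewrite linear_sum /=; apply: ideal_sum => [|i iT]; first exact: ideal_gen.
rewrite (hpartM _ _ (hu i)); case: ifP => _; last by apply: ideal0; apply: ideal_gen.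
by apply: idealM; [apply: ideal_gen | apply: gen_mem].
Qed.

Lemma nzd_ext I J v : (forall a, I a <-> J a) -> nzd I v -> nzd J v.
Proof. by move=> IJ nz a /IJ/nz/IJ. Qed.

Lemma adjoin_ext I J v : (forall a, I a <-> J a) ->
  forall a, adjoin I v a <-> adjoin J v a.
Proof. by move=> IJ a; split=> -[b /IJ h]; exists b. Qed.

(** ** Strongly regular families and exchange *)

(** A homogeneous regular sequence stays regular under permutations; quantifying
    over the subfamilies T makes this part of the definition. *)
Definition strongly_regular u : Prop :=
  forall T i, i \notin T -> nzd (gen u T) (u i).

Definition exch u i w : 'I_n -> R := fun k => if k == i then w else u k.

Lemma gen_exch_out u i w T : i \notin T ->
  forall a, gen (exch u i w) T a <-> gen u T a.
Proof.
move=> iT a; have E (c : 'I_n -> R) : \sum_(k in T) c k * exch u i w k = \sum_(k in T) c k * u k.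
  by apply: eq_bigr => k kT; rewrite /exch; case: eqP kT iT => // -> ->.
by split=> -[c ->]; exists c; rewrite E.
Qed.

Lemma gen_exch_in u i w T : i \in T ->
  forall a, gen (exch u i w) T a <-> adjoin (gen u (T :\ i)) w a.
Proof.
move=> iT a; rewrite -{1}(setD1K iT).
apply: iff_trans (genU1 _ _ _) _; first by rewrite setD11.
rewrite {2}/exch eqxx; apply: adjoin_ext; apply: gen_exch_out.
by rewrite setD11.
Qed.

(** By descending induction on T, w is regular modulo every subfamily that omits
    the exchanged member; the two swaps handle the other cases. *)
Lemma strongly_regular_exch u i w (dg : 'I_n -> nat) e :
  (forall k, u k \is (dg k).-homog) -> (forall k, 0 < dg k)%N ->
  w \is e.-homog ->
  strongly_regular u -> nzd (gen u (~: [set i])) w ->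
  strongly_regular (exch u i w).
Proof.
move=> hu dg0 hw su nzw.
have nzT T : i \notin T -> nzd (gen u T) w.
  have [m] := ubnP #|~: T|; elim: m T => // m IH T cT iT.
  case: (boolP (T == ~: [set i])) => [/eqP -> //|neT].
  have [j jT ji] : exists2 j, j \notin T & j != i.
    have /subsetPn[j] : ~~ (~: [set i] \subset T).
      apply: contra neT => sT; rewrite eqEsubset sT andbT.
      by apply/subsetP => k kT; rewrite !inE; apply: contraNneq iT => <-.
    by rewrite !inE => ji jT; exists j.
  apply: (nzd_swap1 (homog_ideal_gen T hu) (hu j) (dg0 j) hw (su _ _ jT)).
  apply: (nzd_ext (fun a => genU1 u a jT)); apply: IH.
    have -> : ~: (j |: T) = (~: T) :\ j by apply/setP => k; rewrite !inE negb_or.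
    by move: cT; rewrite (cardsD1 j) inE jT.
  by rewrite !inE negb_or eq_sym ji.
move=> T k kT; rewrite {2}/exch; case: eqP => [kE|/eqP ki].
  by rewrite kE in kT; apply: nzd_ext (nzT _ kT) => a; apply: iff_sym; apply: gen_exch_out.
case: (boolP (i \in T)) => iT; last first.
  by apply: nzd_ext (su _ _ kT) => a; apply: iff_sym; apply: gen_exch_out.
apply: (nzd_ext (fun a => iff_sym (gen_exch_in u w iT a))).
have kT' : k \notin T :\ i by rewrite !inE negb_and kT orbT.
apply: nzd_swap2; [exact: ideal_gen|exact: su|].
apply: (nzd_ext (fun a => genU1 u a kT')); apply: nzT.
by rewrite !inE eqxx orbF eq_sym.
Qed.

(** ** Hilbert functions *)

Definition hilbert I (h : nat -> nat) : Prop :=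
  forall j, quot_dim (homog_of j) I (h j).

Lemma hilbert_ext I J h : (forall a, I a <-> J a) -> hilbert I h -> hilbert J h.
Proof.
move=> IJ H j; apply: quot_dim_eq (H j) => //; exact: subspace_homog_of.
Qed.

Definition homog_in j I : R -> Prop := fun a => a \is j.-homog /\ I a.

Lemma subspace_homog_in j I : ideal I -> subspace (homog_in j I).
Proof.
move=> idI; split=> [|c x y [hx Ix] [hy Iy]].
  by split; [apply: rpred0 | apply: ideal0].
by split; [rewrite rpredD ?rpredZ | apply: idealD => //; apply: idealZ].
Qed.

(** Multiplication by w identifies R / (I : w), in degree i, with (I + (w)) / I. *)
Lemma quot_dim_adjoin I w e i j m : homog_ideal I -> w \is e.-homog ->
  j = (i + e)%N ->
  quot_dim (homog_of i) (fun a => I (w * a)) m ->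
  quot_dim (homog_in j (adjoin I w)) I m.
Proof.
move=> hI hw jE; have [idI _] := hI.
apply: (@quot_dim_map _ _ _ ( *%R w)).
- by move=> c x y; rewrite mulrDr -scalerAr.
- exact: subspace_homog_of.
- exact: subspace_ideal.
- move=> a ha; split; last by rewrite mulrC; apply: adjoinv.
  by rewrite mulrC jE; apply: dhomogM.
- by [].
move=> a [ha Aa]; case: (adjoin_homog hI hw ha Aa) => [Ia|[b [_ hb] Ib]].
  by exists 0; [apply: rpred0 | rewrite mulr0 subr0].
by exists b; [move: hb; rewrite jE addnK | rewrite mulrC].
Qed.

Lemma quot_dim_adjoin_low I w e j : homog_ideal I -> w \is e.-homog ->
  (j < e)%N -> quot_dim (homog_in j (adjoin I w)) I 0.
Proof.
move=> hI hw lt_je; apply/quot_dim0 => a [ha Aa].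
by case: (adjoin_homog hI hw ha Aa) => // -[b []]; rewrite leqNgt lt_je.
Qed.

Lemma quot_dim_homog_adjoin I w j m m' : ideal I ->
  quot_dim (homog_of j) (adjoin I w) m ->
  quot_dim (homog_in j (adjoin I w)) I m' ->
  quot_dim (homog_of j) I (m + m').
Proof.
move=> idI q q'.
have sA := subspace_homog_of j.
have sB : subspace (homog_in j (adjoin I w)).
  by apply: subspace_homog_in; apply: ideal_adjoin.
apply: (quot_dim_add sA sB) q'; first by move=> x [].
  by move=> x hx Ix; split=> //; apply: adjoinS.
by apply: quot_dim_eq q => // a ha; split=> [|[]].
Qed.

Lemma hilbert_of_adjoin I v h : homog_ideal I -> v \is 1.-homog -> nzd I v ->
  hilbert (adjoin I v) h -> hilbert I (fun j => \sum_(i < j.+1) h i)%N.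
Proof.
move=> hI hv nz H; have [idI _] := hI; elim=> [|j IH].
  rewrite big_ord1 -[h _]addn0; apply: quot_dim_homog_adjoin (H 0%N) _ => //.
  exact: quot_dim_adjoin_low hv _.
rewrite big_ord_recr /= addnC; apply: quot_dim_homog_adjoin (H _) _ => //.
apply: (quot_dim_adjoin hI hv (esym (addn1 j))).
apply: quot_dim_eq IH => //; first exact: subspace_homog_of.
by move=> a _; split=> [|/nz //]; apply: idealM.
Qed.

Lemma quot_dim_mod_adjoin I w e j m m' :
  homog_ideal I -> w \is e.-homog ->
  quot_dim (homog_of j) I m ->
  (forall i, j = (i + e)%N -> quot_dim (homog_of i) (fun a => I (w * a)) m') ->
  ((j < e)%N -> m' = 0%N) ->
  (m' <= m)%N /\ quot_dim (homog_of j) (adjoin I w) (m - m').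
Proof.
move=> hI hw q q' m'0; have [idI _] := hI.
have idA := ideal_adjoin w idI.
have [] := quot_dim_split (A := homog_of j) (B := homog_in j (adjoin I w)) (C := I) _ _ _ _ _ q.
- exact: subspace_homog_of.
- exact: subspace_homog_in.
- exact: subspace_ideal.
- by move=> x [].
- by move=> x hx Ix; split=> //; apply: adjoinS.
move=> m1 [m2 [q1 q2 mE]].
have m2E : m2 = m'.
  apply: quot_dim_uniq (subspace_ideal idI) q2 _.
  case: (ltnP j e) => [lt_je|le_ej].
    by rewrite m'0 //; apply: quot_dim_adjoin_low hw _.
  by apply: (quot_dim_adjoin hI hw (esym (subnK le_ej))); apply: q'; rewrite subnK.
rewrite mE m2E leq_addl addnK; split=> //.
apply: quot_dim_eq q1 => //; first exact: subspace_homog_of.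
by move=> a ha; split=> [[]|].
Qed.

Lemma hilbert_adjoin I w e h : homog_ideal I -> w \is e.-homog -> nzd I w ->
  hilbert I h ->
  hilbert (adjoin I w) (fun j => h j - (if e <= j then h (j - e) else 0))%N.
Proof.
move=> hI hw nz H j; have [idI _] := hI.
apply: (quot_dim_mod_adjoin hI hw (H j) _ _).2.
  move=> i ->; rewrite leq_addl addnK; apply: quot_dim_eq (H i) => //.
    exact: subspace_homog_of.
  by move=> a _; split=> [|/nz //]; apply: idealM.
by case: leqP.
Qed.

(** Multiplication of the series with coefficients h by 1 + t + ... + t^(e-1). *)
Definition widen e (h : nat -> nat) (j : nat) : nat :=
  (\sum_(i < j.+1 | j < i + e) h i)%N.

Lemma sum_widen e (h : nat -> nat) j : (\sum_(i < j.+1) h i =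
  widen e h j + (if e <= j then \sum_(i < (j - e).+1) h i else 0))%N.
Proof.
rewrite /widen; case: leqP => [le_ej|lt_je]; last first.
  by rewrite addn0; apply: eq_bigl => i; lia.
rewrite -!(big_mkord xpredT h) -(big_mkord (fun i => j < i + e)%N h).
rewrite addnC (big_cat_nat (n := (j - e).+1)) //=; last by lia.
rewrite [X in _ = (_ + X)%N](big_cat_nat (n := (j - e).+1)) //=; last by lia.
rewrite [X in _ = (_ + (X + _))%N]big_nat_cond.
rewrite [X in _ = (_ + (X + _))%N]big_pred0 ?add0n; last by move=> i; lia.
congr (_ + _)%N; rewrite [RHS]big_nat_cond big_nat_cond.
by apply: eq_bigl => i; lia.
Qed.

Lemma hilbert_exch I v w e h : homog_ideal I ->
  v \is 1.-homog -> nzd I v -> w \is e.-homog -> nzd I w ->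
  hilbert (adjoin I v) h -> hilbert (adjoin I w) (widen e h).
Proof.
move=> hI hv nzv hw nzw H j.
have := hilbert_adjoin hI hw nzw (hilbert_of_adjoin hI hv nzv H) j.
by rewrite (sum_widen e) addnK.
Qed.

(** ** Socles *)

(** The socle of R / I consists of the classes killed by all variables. *)
Definition socle_in_degree I (t : nat) : Prop :=
  forall j a, a \is j.-homog -> j <> t ->
    (forall k, I ('X_k * a)) -> I a.

Lemma linear_formE v : v \is 1.-homog -> v = \sum_k v@_U_(k) *: 'X_k.
Proof.
move=> /dhomogP hv; apply/mpolyP => m; rewrite raddf_sum /=.
under eq_bigr do rewrite mcoeffZ mcoeffX.
case: (boolP (m \in msupp v)) => [/hv/eqP m1|mv].
  have [i /eqP mE] := mdeg1P _ m1.
  rewrite mE (bigD1 i) //= eqxx mulr1 big1 ?addr0 // => k ki.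
  by rewrite eq_mnm1 (negPf ki) mulr0.
rewrite memN_msupp_eq0 // big1 // => k _; case: eqP => [kE|]; last by rewrite mulr0.
by rewrite kE memN_msupp_eq0 ?mul0r.
Qed.

Lemma ideal_linear_form I v a : ideal I -> v \is 1.-homog ->
  (forall k, I ('X_k * a)) -> I (v * a).
Proof.
move=> idI /linear_formE -> h; rewrite mulr_suml; apply: ideal_sum => // k _.
by rewrite -scalerAl; apply: idealZ.
Qed.

(** Multiplication by w and by v identifies the socles of R / (I + (v)) and of
    R / (I + (w)) with that of R / (I + (v w)), shifting degrees by e and 1. *)
Lemma socle_exch I v w e t : homog_ideal I -> (0 < e)%N ->
  v \is 1.-homog -> nzd I v -> w \is e.-homog -> nzd I w ->
  socle_in_degree (adjoin I v) t -> socle_in_degree (adjoin I w) (t + e).-1.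
Proof.
move=> hI e0 hv nzv hw nzw soc j a ha jt socA; have [idI _] := hI.
have idA := ideal_adjoin w idI.
have hva : a * v \is (j + 1).-homog by apply: dhomogM.
have Ava : adjoin I w (a * v) by rewrite mulrC; apply: ideal_linear_form.
case: (adjoin_homog hI hw hva Ava) => [Iva|[b [le_e hb] Ib]].
  by apply/adjoinS/nzv; rewrite mulrC.
have [c Ic] : adjoin I v b.
  apply: (soc _ _ hb); first by move: jt; lia.
  move=> k; have [c Ic] := socA k; exists c; apply: nzw.
  have -> : w * ('X_k * b - c * v) =
      ('X_k * a - c * w) * v - 'X_k * (a * v - b * w) by ring.
  by apply: idealB => //; [apply: idealMr | apply: idealM].
exists c; apply: nzv.
have -> : v * (a - c * w) = (a * v - b * w) + (b - c * v) * w by ring.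
by apply: idealD => //; apply: idealMr.
Qed.

(** ** Dehomogenization by a linear form *)

(** Suppose a - c (v - 1) lies in I and multiply by 1 + v + ... + v^(N-1): modulo
    I, the sum of the forms v^i a equals c v^N - c, which has no component in the
    degrees between deg c and N. *)
Lemma dehomogP I v j a : homog_ideal I -> v \is 1.-homog -> a \is j.-homog ->
  adjoin I (v - 1) a <-> exists N, I (v ^+ N * a).
Proof.
move=> [idI hI] hv ha; have hvX i : v ^+ i \is i.-homog.
  by have := dhomogMn i hv; rewrite mul1n.
split=> [[c Ic]|[N IN]]; last first.
  have [b bE] : exists b, v ^+ N - 1 = b * (v - 1).
    by exists (\sum_(i < N) v ^+ i); rewrite mulrC subrX1.
  exists (- (b * a)).
  have -> : a - - (b * a) * (v - 1) = v ^+ N * a - ((v ^+ N - 1) - b * (v - 1)) * a by ring.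
  by rewrite bE subrr mul0r subr0.
pose L := msize c; exists L; pose N := (L + j + 1)%N.
have /(hI (L + j)%N) : I ((\sum_(i < N) v ^+ i) * (a - c * (v - 1))) by apply: idealM.
have -> : (\sum_(i < N) v ^+ i) * (a - c * (v - 1)) =
          \sum_(i < N) v ^+ i * a - (c * v ^+ N - c).
  have := subrX1 v N; set S := \sum_(i < N) _ => SE.
  rewrite -mulr_suml -/S mulrBr; congr (_ - _).
  by rewrite mulrCA [S * _]mulrC -SE mulrBr mulr1.
rewrite !linearB /= (hpartM _ _ (hvX N)) ifN; last by rewrite /N; lia.
have -> : hpart (L + j) c = 0.
  rewrite pihomogE big_seq_cond big1 // => m /andP[/msize_mdeg_lt lt_m /eqP mE].
  by rewrite mE -/L in lt_m; lia.
rewrite subrr addr0 linear_sum /=.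
have lt_LN : (L < N)%N by rewrite /N; lia.
rewrite (bigD1 (Ordinal lt_LN)) //= pihomog_dE ?dhomogM // big1 ?addr0 // => i ne.
have hi : v ^+ i * a \is (i + j).-homog by apply: dhomogM.
rewrite (pihomog_ne0 _ hi) //; apply/eqP => /addIn E; case/eqP: ne.
exact: val_inj.
Qed.

Lemma nzd_exp I v N a : nzd I v -> I (v ^+ N * a) -> I a.
Proof. by move=> nz; elim: N => [|N IH]; rewrite ?mul1r // exprS -mulrA => /nz/IH. Qed.

Lemma dehomog_nzd I v j a : homog_ideal I -> v \is 1.-homog -> nzd I v ->
  a \is j.-homog -> adjoin I (v - 1) a <-> I a.
Proof.
move=> hI hv nz ha; split; last exact: adjoinS.
by move/(dehomogP hI hv ha) => [N /nzd_exp]; apply.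
Qed.

(** When R / (I + (v)) vanishes above degree t, putting v = 1 identifies every
    homogeneous part of R / I of degree at least t with R / (I + (v - 1)). *)
Section FiniteQuotient.
Variables (I : R -> Prop) (v : R) (h : nat -> nat) (t : nat).
Hypotheses (hI : homog_ideal I) (hv : v \is 1.-homog) (H : hilbert (adjoin I v) h).
Hypothesis h0 : forall j, (t < j)%N -> h j = 0%N.

Lemma dehomog_onto j a : (t <= j)%N ->
  exists2 b, b \is j.-homog & adjoin I (v - 1) (a - b).
Proof.
move=> le_tj; have [idI _] := hI; have idQ := ideal_adjoin (v - 1) idI.
elim/homog_ind: a => [|x y [x' hx Qx] [y' hy Qy]|i a].
- by exists 0; [apply: rpred0 | rewrite subr0; apply: ideal0].
- exists (x' + y'); first exact: rpredD.
  by rewrite opprD addrACA; apply: idealD.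
case: (leqP i j) => [le_ij ha|lt_ji].
  exists (v ^+ (j - i) * a).
    rewrite -{2}(subnK le_ij); apply: dhomogM => //.
    by have := dhomogMn (j - i) hv; rewrite mul1n.
  exists (- (\sum_(k < j - i) v ^+ k) * a).
  have := subrX1 v (j - i); set S := \sum_(k < _) _ => SE.
  have -> : a - v ^+ (j - i) * a - - S * a * (v - 1) =
    a * (1 - v ^+ (j - i) + (v - 1) * S) by ring.
  by rewrite -SE addrC addrA subrK subrr mulr0; apply: ideal0.
(* in degrees above t every form is divisible by v modulo I *)
elim: i lt_ji a => // i IH; rewrite ltnS => le_ji a ha.
have : adjoin I v a.
  have := H i.+1; rewrite h0 ?ltnS ?(leq_trans le_tj) // => /quot_dim0; exact.
case/(adjoin_homog hI hv ha) => [Ia|[b [_ hb] Ib]].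
  by exists 0; [apply: rpred0 | rewrite subr0; apply: adjoinS].
rewrite subSS subn0 in hb.
have [b' hb' Qb] : exists2 b', b' \is j.-homog & adjoin I (v - 1) (b - b').
  case: (ltnP j i) => [lt_ji|le_ij]; first exact: IH.
  have <- : i = j by apply/eqP; rewrite eqn_leq le_ij.
  by exists b => //; rewrite subrr; apply: ideal0.
exists b' => //.
have -> : a - b' = (a - b * v) + b * (v - 1) + (b - b') by ring.
apply: idealD => //; apply: idealD => //; first exact: adjoinS.
exact: adjoinv.
Qed.

Lemma quot_dim_dehomog j : nzd I v -> (t <= j)%N ->
  quot_dim (fun=> True) (adjoin I (v - 1)) (\sum_(i < j.+1) h i).
Proof.
move=> nz le_tj; have [idI _] := hI; have idQ := ideal_adjoin (v - 1) idI.
apply: (@quot_dim_map _ _ _ id _ (homog_of j) I); last 1 first.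
- exact: (hilbert_of_adjoin hI hv nz H j).
- by [].
- exact: subspace_homog_of.
- exact: subspace_ideal.
- by [].
- by move=> a ha; apply: iff_sym; apply: dehomog_nzd ha.
- by move=> a _; apply: dehomog_onto.
Qed.

End FiniteQuotient.

End Ideals.

(** * Points of ideals of finite codimension *)

Section Points.
Variables (K : fieldType) (n : nat).
Local Notation R := {mpoly K[n]}.
Implicit Types (p : 'rV[K]_n) (q : R).

Lemma evD p : {morph ev p : x y / x + y}. Proof. exact: mevalD. Qed.
Lemma evB p : {morph ev p : x y / x - y}. Proof. exact: mevalB. Qed.
Lemma evM p : {morph ev p : x y / x * y}. Proof. exact: mevalM. Qed.
Lemma evC p c : ev p c%:MP = c. Proof. exact: mevalC. Qed.
Lemma ev0 p : ev p 0 = 0. Proof. exact: meval0. Qed.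
Lemma ev1 p : ev p 1 = 1. Proof. exact: meval1. Qed.
Lemma evXU p k : ev p 'X_k = p 0 k. Proof. exact: mevalXU. Qed.
Lemma evZ p c q : ev p (c *: q) = c * ev p q. Proof. exact: mevalZ. Qed.
Lemma ev_sum p (T : finType) (P : pred T) (F : T -> R) :
  ev p (\sum_(i | P i) F i) = \sum_(i | P i) ev p (F i).
Proof. exact: raddf_sum. Qed.
Lemma evX p q k : ev p (q ^+ k) = ev p q ^+ k. Proof. exact: rmorphXn. Qed.

Lemma mpoly_alg_ind (P : R -> Prop) :
  (forall c, P c%:MP) -> (forall k, P 'X_k) ->
  (forall x y, P x -> P y -> P (x + y)) ->
  (forall x y, P x -> P y -> P (x * y)) -> forall q, P q.
Proof.
move=> PC PX PD PM; apply: mpolyind => [|c m q _ _ Pq].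
  by rewrite -mpolyC0; apply: PC.
apply: PD => //; rewrite -mul_mpolyC; apply: (PM) => //.
rewrite mpolyXE_id; elim/big_rec: _ => [|k x _ Px]; first by rewrite -mpolyC1.
apply: (PM) => //; elim: (m k) => [|i IH]; first by rewrite expr0 -mpolyC1.
by rewrite exprS; apply: PM.
Qed.

Definition vanish p : R -> Prop := fun q => ev p q = 0.

Lemma ideal_vanish p : ideal (vanish p).
Proof.
split=> [|x y|c x]; rewrite /vanish ?ev0 // ?evD ?evM.
  by move=> -> ->; rewrite addr0.
by move=> ->; rewrite mulr0.
Qed.

Lemma hadamard p q :
  exists c : 'I_n -> R, q = (ev p q)%:MP + \sum_k c k * ('X_k - (p 0 k)%:MP).
Proof.
elim/mpoly_alg_ind: q => [a|k|x y [c cE] [c' c'E]|x y [c cE] [c' c'E]].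
- exists (fun=> 0); rewrite evC big1 ?addr0 // => k _; exact: mul0r.
- exists (fun i => (i == k)%:R); rewrite evXU (bigD1 k) //= eqxx mul1r.
  rewrite big1 ?addr0 => [|i /negPf ->]; last by rewrite mul0r.
  by rewrite addrC subrK.
- exists (fun i => c i + c' i); rewrite {1}cE {1}c'E evD mpolyCD addrACA.
  by congr (_ + _); rewrite -big_split; apply: eq_bigr => i _; rewrite mulrDl.
- exists (fun i => c i * y + (ev p x)%:MP * c' i); rewrite evM mpolyCM.
  under eq_bigr do rewrite mulrDl -(mulrA (ev p x)%:MP) (mulrAC (c _)).
  rewrite big_split /= -mulr_suml -mulr_sumr.
  set X := \sum_i _ in cE *; set Y := \sum_i _ in c'E *.
  have -> : X = x - (ev p x)%:MP by rewrite {1}cE addrC addKr.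
  have -> : Y = y - (ev p y)%:MP by rewrite {1}c'E addrC addKr.
  by ring.
Qed.

(** Every polynomial differs from its value at p by a combination of the X_k - p_k,
    so the eigenvalues of the variables determine those of all polynomials. *)
Lemma eval_mod (Q : R -> Prop) p b : ideal Q ->
  (forall k, Q (('X_k - (p 0 k)%:MP) * b)) ->
  forall q, Q ((q - (ev p q)%:MP) * b).
Proof.
move=> idQ h q; have [c cE] := hadamard p q.
rewrite {1}cE addrC addKr mulr_suml; apply: ideal_sum => // k _.
by rewrite -mulrA; apply: idealM.
Qed.

Lemma ideal_quot Q w : ideal Q -> ideal (fun b : R => Q (w * b)).
Proof.
move=> idQ; split=> [|x y Qx Qy|c x Qx].
- by rewrite mulr0; apply: ideal0.
- by rewrite mulrDr; apply: idealD.
- by rewrite mulrCA; apply: idealM.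
Qed.

End Points.

Section ClosedPoints.
Variables (K : numClosedFieldType) (n : nat).
Local Notation R := {mpoly K[n]}.
Implicit Types (p : 'rV[K]_n) (q : R).

(** The form of the Nullstellensatz used throughout: a nonzero finite
    dimensional module P / Q has a joint eigenvector b of the variables. *)
Lemma point_of_quot (Q P : R -> Prop) m : ideal Q -> ideal P ->
  quot_dim P Q m -> (0 < m)%N ->
  exists p b, [/\ P b, ~ Q b & forall q, Q ((q - (ev p q)%:MP) * b)].
Proof.
move=> idQ idP [e [Pe gen_e ind]] m0.
have xe k i : exists c : 'I_m -> K, Q ('X_k * e i - \sum_j c j *: e j).
  by apply: gen_e; apply: idealM.
have /fin_all_exists[c cE] k := fin_all_exists (xe k).
pose X k := \matrix_(i, j) c k i j.
pose E (v : 'rV_m) := \sum_i v 0 i *: e i.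
have EB v w : E (v - w) = E v - E w.
  by rewrite -sumrB; apply: eq_bigr => i _; rewrite !mxE scalerBl.
have E0 v : Q (E v) -> v = 0.
  by move=> /(ind (fun i => v 0 i)) h; apply/rowP => i; rewrite h mxE.
have XE k v : Q ('X_k * E v - E (v *m X k)).
  have -> : E (v *m X k) = \sum_i v 0 i *: \sum_j c k i j *: e j.
    under [RHS]eq_bigr do rewrite scaler_sumr.
    rewrite exchange_big /=; apply: eq_bigr => j _; rewrite mxE scaler_suml.
    by apply: eq_bigr => i _; rewrite mxE scalerA.
  rewrite mulr_sumr -sumrB; apply: ideal_sum => // i _.
  by rewrite -scalerAr -scalerBr; apply: idealZ.
have comX k l : X k *m X l = X l *m X k.
  apply/row_matrixP => i; rewrite !rowE !mulmxA; apply/eqP; rewrite -subr_eq0.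
  apply/eqP/E0; rewrite EB; set v := delta_mx _ _.
  have -> : E (v *m X k *m X l) - E (v *m X l *m X k) =
    ('X_k * ('X_l * E v - E (v *m X l)) + ('X_k * E (v *m X l) - E (v *m X l *m X k)))
    - ('X_l * ('X_k * E v - E (v *m X k)) + ('X_l * E (v *m X k) - E (v *m X k *m X l))).
    by ring.
  by apply: idealB => //; apply: idealD => //; apply: idealM.
have [] := @common_eigenvector K m [seq X k | k : 'I_n] m0.
  by move=> _ _ /mapP[k _ ->] /mapP[l _ ->]; apply: comX.
move=> v v0 /allP st.
have /fin_all_exists[a aE] k : exists a, v *m X k = a *: v.
  by apply/sub_rVP; apply: st; apply: map_f; rewrite mem_enum.
pose p := \row_k a k; exists p, (E v); split.
- by apply: ideal_sum => // i _; apply: idealZ.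
- by move/E0/eqP; apply/negP.
- apply: eval_mod => // k; rewrite mxE mulrBl mul_mpolyC.
  have <- : E (v *m X k) = a k *: E v; last exact: XE.
  by rewrite aE /E scaler_sumr; apply: eq_bigr => i _; rewrite mxE scalerA.
Qed.

Lemma point_vanish (Q : R -> Prop) p b : ideal Q -> ~ Q b ->
  (forall q, Q ((q - (ev p q)%:MP) * b)) -> forall q, Q (q * b) -> ev p q = 0.
Proof.
move=> idQ nQb h q Qq; apply/eqP; apply: contra_notT nQb => q0.
have -> : b = (ev p q)^-1 *: (q * b - (q - (ev p q)%:MP) * b).
  by rewrite mulrBl opprB addrC subrK mul_mpolyC scalerA mulVf // scale1r.
by apply: idealZ => //; apply: idealB.
Qed.

(** The classes of R / (I + (v - 1)) killed by w would contain a joint eigenvector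
    of the variables, hence a point where v = 1 and w vanishes. *)
Lemma nzd_of_points (I : R -> Prop) v w h t e : homog_ideal I ->
  v \is 1.-homog -> nzd I v -> hilbert (adjoin I v) h ->
  (forall j, (t < j)%N -> h j = 0%N) -> w \is e.-homog ->
  (forall p, (forall a, I a -> ev p a = 0) -> ev p v = 1 -> ev p w <> 0) ->
  nzd I w.
Proof.
move=> hI hv nzv H h0 hw pts; apply: (nzd_homog hI hw) => j a ha Iwa.
have [idI _] := hI; have idQ := ideal_adjoin (v - 1) idI.
set Q := adjoin I (v - 1) in idQ.
have idP := ideal_quot w idQ.
have [//|nIa] := boolp.EM (I a).
have [||||| m1 [m2 [_ qPQ _]]] := quot_dim_split (A := fun=> True)
  (B := fun b => Q (w * b)) (C := Q) _ _ _ _ _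
  (quot_dim_dehomog hI hv H h0 nzv (leqnn t)); try by [].
- exact: subspace_ideal.
- exact: subspace_ideal.
- by move=> x _; apply: idealM.
case: m2 qPQ => [/quot_dim0 PQ|m2 qPQ].
  case: nIa; apply/(dehomog_nzd hI hv nzv ha)/PQ; exact: adjoinS.
have [p [b [Pb nQb hb]]] := point_of_quot idQ idP qPQ isT.
have zQ := point_vanish idQ nQb hb.
case: (pts p) => [a' Ia'||].
- by apply: zQ; apply: idealMr => //; apply: adjoinS.
- apply/eqP; rewrite -subr_eq0 -[X in _ - X](ev1 p) -evB; apply/eqP/zQ.
  by apply: idealMr => //; rewrite -[_ - _]mul1r; apply: adjoinv.
- exact: zQ.
Qed.

(** For each k, the powers of X_k are dependent modulo Q, so the k-th coordinates
    of the zeros of Q are roots of one polynomial. *)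
Lemma finite_points (Q : R -> Prop) D : ideal Q -> quot_dim (fun=> True) Q D ->
  exists r : seq 'rV[K]_n, forall p, (forall q, Q q -> ev p q = 0) -> p \in r.
Proof.
move=> idQ qQ.
have roots k : exists r : seq K,
    forall p, (forall q, Q q -> ev p q = 0) -> p 0 k \in r.
  have : ~ indep_mod (fun=> True) Q (fun i : 'I_D.+1 => 'X_k ^+ i : R).
    by move=> /(indep_mod_le (subspace_ideal idQ) qQ); rewrite ltnn.
  move=> nind; have [c [Qc [i ci]]] : exists c : 'I_D.+1 -> K,
      Q (\sum_i c i *: 'X_k ^+ i) /\ exists i, c i <> 0.
    apply: boolp.contrapT => no; apply: nind; split=> // c Qc i.
    by apply: boolp.contrapT => ci; apply: no; exists c; split=> //; exists i.
  pose chi : {poly K} := \poly_(i < D.+1) c (inord i).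
  have chi0 : chi != 0.
    apply/eqP => /polyP/(_ i); rewrite coef_poly ltn_ord inord_val coef0.
    exact: ci.
  have [r rE] := closed_field_poly_normal chi; exists r => p zp.
  have : root chi (p 0 k).
    apply/rootP; rewrite horner_poly; apply: etrans (zp _ Qc).
    rewrite ev_sum; apply: eq_bigr => l _.
    by rewrite inord_val evZ evX evXU.
  rewrite rE rootZ ?lead_coef_eq0 // root_prod_XsubC //.
have /fin_all_exists[r rE] := roots.
pose N := \max_k size (r k).
exists [seq \row_k nth 0 (r k) (phi k) | phi : {ffun 'I_n -> 'I_N}] => p zp.
have lt_N k : (index (p 0%R k) (r k) < N)%N.
  apply: leq_trans (leq_bigmax k); rewrite index_mem; exact: rE.
apply/mapP; exists [ffun k => Ordinal (lt_N k)]; first by rewrite mem_enum.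
by apply/rowP => k; rewrite mxE ffunE /= nth_index //; apply: rE.
Qed.

(** Coefficient vectors on the moment curve: any n of them are independent, and
    a nonzero linear condition excludes only finitely many of them. *)
Definition moment_comb (f : 'I_n -> R) (t : K) : R := \sum_(i < n) t ^+ i *: f i.

Lemma moment_comb_avoid (f : 'I_n -> R) (r : seq 'rV[K]_n) (bad : seq K) :
  exists2 t, t \notin bad &
  forall p, p \in r -> (exists i, ev p (f i) != 0) -> ev p (moment_comb f t) != 0.
Proof.
pose F p : {poly K} := \poly_(i < n) (if insub i is Some k then ev p (f k) else 0).
have FE p t : (F p).[t] = ev p (moment_comb f t).
  rewrite horner_poly ev_sum; apply: eq_bigr => i _.
  by rewrite valK evZ mulrC.
pose Phi := (\prod_(p <- r | F p != 0) F p) * \prod_(b <- bad) ('X - b%:P).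
have : Phi != 0.
  apply: mulf_neq0; last exact/monic_neq0/monic_prod_XsubC.
  by elim/big_rec: _ => [|p x p0 x0]; rewrite ?oner_eq0 ?mulf_neq0.
case/closed_nonrootP => t; rewrite rootM negb_or root_prod_XsubC => /andP[nr nb].
exists t => // p pr [i fi]; rewrite -FE.
apply: contra nr => /eqP Ft; rewrite (big_rem p) //= ifT ?rootM.
  by rewrite rootE Ft eqxx.
apply/eqP => /polyP/(_ i); rewrite coef_poly ltn_ord valK coef0; exact/eqP.
Qed.

(** ** Complete intersections *)

(** The invariants of a complete intersection of dimension zero that survive
    the exchange of a linear form for a form of higher degree. *)
Record complete_intersection (u : 'I_n -> R) (dg : 'I_n -> nat)
    (h : nat -> nat) (t : nat) : Prop := CompleteIntersection {
  ci_homog : forall k, u k \is (dg k).-homog;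
  ci_deg : forall k, (0 < dg k)%N;
  ci_regular : strongly_regular u;
  ci_hilbert : hilbert (gen u setT) h;
  ci_top : forall j, (t < j)%N -> h j = 0%N;
  ci_socle : socle_in_degree (gen u setT) t }.

Definition zero_vars (T : {set 'I_n}) : n.-tuple R :=
  [tuple if i \in T then 0 else 'X_i | i < n].

(** Setting the variables in T to zero is a ring morphism with kernel (X_i, i in T),
    so that regularity of the variables reduces to integrality of R. *)
Lemma gen_vars (T : {set 'I_n}) a :
  gen (fun i => 'X_i) T a <-> a \mPo zero_vars T = 0.
Proof.
have zX i : 'X_i \mPo zero_vars T = if i \in T then 0 else 'X_i :> R.
  by rewrite comp_mpolyXU -tnth_nth tnth_mktuple.
split=> [[c ->]|a0].
  rewrite raddf_sum /= big1 // => i iT; rewrite rmorphM /= zX iT mulr0 //.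
have idG := ideal_gen (fun i => 'X_i : R) T.
suff h : gen (fun i => 'X_i) T (a - (a \mPo zero_vars T)) by rewrite a0 subr0 in h.
elim/mpoly_alg_ind: {a0} a => [c|k|x y hx hy|x y hx hy].
- by rewrite comp_mpolyC subrr; apply: ideal0.
- rewrite zX; case: ifP => kT; first by rewrite subr0; apply: (gen_mem _ kT).
  by rewrite subrr; apply: ideal0.
- by rewrite comp_mpolyD opprD addrACA; apply: idealD.
- rewrite rmorphM /=; set x' := x \mPo _ in hx *; set y' := y \mPo _ in hy *.
  have -> : x * y - x' * y' = (x - x') * y + x' * (y - y') by ring.
  by apply: idealD => //; [apply: idealMr | apply: idealM].
Qed.

Lemma gen_vars_pos j a : a \is j.-homog -> (0 < j)%N ->
  gen (fun i => 'X_i : R) setT a.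
Proof.
move=> ha j0; have [c cE] := hadamard 0 a; exists c; rewrite {1}cE.
have -> : ev 0 a = 0.
  rewrite /ev mevalE big_seq big1 // => m ma; have := dhomog_mf ha ma => mj.
  have : mdeg m != 0%N by rewrite mj -lt0n.
  rewrite mdeg_eq0 => m0; have [i mi] : exists i, m i != 0%N.
    apply/existsP; apply: contraNT m0; rewrite negb_exists => /forallP h.
    by apply/eqP/mnmP => i; have := h i; rewrite negbK mnm0E => /eqP.
  by rewrite (bigD1 i) //= mxE expr0n (negPf mi) mul0r mulr0.
rewrite mpolyC0 add0r; apply: eq_big => [i|i _]; first by rewrite inE.
by rewrite mxE mpolyC0 subr0.
Qed.

Lemma ci_vars : complete_intersection (fun i => 'X_i) (fun=> 1%N)
  (fun j => (j == 0)%N : nat) 0.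
Proof.
split=> //.
- by move=> k; rewrite dhomogX /= mdeg1.
- move=> T i iT a /gen_vars; rewrite rmorphM /= comp_mpolyXU -tnth_nth.
  rewrite tnth_mktuple (negPf iT) => /eqP; rewrite mulf_eq0 => /orP[|/eqP].
    by rewrite -msupp_eq0 msuppX.
  by move/gen_vars.
- case=> [|j]; last by apply/quot_dim0 => a ha; apply: gen_vars_pos ha _.
  exists (fun=> 1); split=> [_|a ha|c]; first exact: dhomog1.
    exists (fun=> ev 0 a); have [c cE] := hadamard 0 a; exists c.
    rewrite big_ord1 alg_mpolyC {1}cE addrC addKr.
    apply: eq_big => [i|i _]; first by rewrite inE.
    by rewrite mxE mpolyC0 subr0.
  rewrite big_ord1 alg_mpolyC => -[b bE] i; rewrite ord1 -(evC (0 : 'rV_n) (c ord0)) bE.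
  by rewrite ev_sum big1 // => k _; rewrite evM evXU mxE mulr0.
- by case.
- by move=> j a ha; case: j ha => // j ha _ _; apply: gen_vars_pos ha _.
Qed.

Lemma gen_setT (u : 'I_n -> R) i a :
  gen u setT a <-> adjoin (gen u (~: [set i])) (u i) a.
Proof.
have -> : [set: 'I_n] = i |: ~: [set i] by rewrite setUCr.
by apply: genU1; rewrite !inE eqxx.
Qed.

Lemma ci_exch u dg h t i w e : complete_intersection u dg h t ->
  dg i = 1%N -> w \is e.-homog -> (0 < e)%N ->
  (forall p, (forall k, k != i -> ev p (u k) = 0) -> ev p (u i) = 1 ->
     ev p w <> 0) ->
  complete_intersection (exch u i w) (fun k => if k == i then e else dg k)
    (widen e h) (t + e).-1.
Proof.
move=> [hu dg0 su H h0 soc] di hw e0 pts.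
set I := gen u (~: [set i]).
have hI : homog_ideal I := homog_ideal_gen _ hu.
have hv : u i \is 1.-homog by rewrite -di.
have nzv : nzd I (u i) by apply: su; rewrite !inE eqxx.
have H' := hilbert_ext (gen_setT u i) H.
have nzw : nzd I w.
  apply: (nzd_of_points hI hv nzv H' h0 hw) => p zp vp; apply: pts => // k ki.
  by apply: zp; apply: gen_mem; rewrite !inE.
have E a : gen (exch u i w) setT a <-> adjoin I w a.
  apply: iff_trans (gen_setT _ i a) _; rewrite /exch eqxx; apply: adjoin_ext.
  by apply: gen_exch_out; rewrite !inE eqxx.
split.
- by move=> k; rewrite /exch; case: eqP.
- by move=> k; case: eqP.
- exact: strongly_regular_exch hu dg0 hw su nzw.
- apply: hilbert_ext (fun a => iff_sym (E a)) _; exact: hilbert_exch hI hv nzv hw nzw H'.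
- by move=> j lt_j; rewrite /widen big1 // => k lt_jk; apply: h0; lia.
- have soc' : socle_in_degree (adjoin I (u i)) t.
    move=> j a ha jt Ia; apply/(gen_setT u i a)/(soc j) => // k.
    exact/(gen_setT u i).
  move=> j a ha jt Ia; apply/E.
  apply: (socle_exch hI e0 hv nzv hw nzw soc' ha jt) => k; exact/E.
Qed.

Lemma widen1 h : widen 1 h = h.
Proof.
apply: boolp.funext => j; rewrite /widen.
rewrite (big_pred1 (ord_max : 'I_j.+1)) // => i.
by rewrite /= -val_eqE /=; have := ltn_ord i; lia.
Qed.

(** Forms of degree e without a common zero on the hyperplane l = 0 have linear
    combinations which, together with l, form a complete intersection: they are
    exchanged one after the other against variables, each chosen so as not to
    vanish at the finitely many points cut out by the others. *)
Lemma ci_generic (f : 'I_n -> R) e l : (0 < e)%N ->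
  (forall i, f i \is e.-homog) -> l \is 1.-homog -> l != 0 ->
  (forall p, p != 0 -> ev p l = 0 -> exists i, ev p (f i) != 0) ->
  exists i0 (t : 'I_n -> K) u,
    [/\ injective t, u i0 = l, forall i, i != i0 -> u i = moment_comb f (t i)
      & complete_intersection u (fun i => if i == i0 then 1%N else e)
          (iter n.-1 (widen e) (fun j => (j == 0)%N : nat)) (n.-1 * e.-1)].
Proof.
move=> e0 hf hl l0 pts.
have [i0 li0] : exists i0, l@_U_(i0) != 0.
  apply/existsP; apply: contraNT l0; rewrite negb_exists => /forallP h.
  rewrite (linear_formE hl) big1 // => k _.
  by have := h k; rewrite negbK => /eqP ->; rewrite scale0r.
have hw t : moment_comb f t \is e.-homog.
  by apply: rpred_sum => i _; apply: rpredZ.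
suff key : forall s, uniq s -> i0 \notin s -> exists (t : 'I_n -> K) u,
    [/\ {in s &, injective t}, u i0 = l,
        forall i, i \in s -> u i = moment_comb f (t i),
        forall i, i \notin i0 :: s -> u i = 'X_i
      & complete_intersection u (fun i => if i \in s then e else 1%N)
          (iter (size s) (widen e) (fun j => (j == 0)%N : nat)) (size s * e.-1)].
  have [] := key (enum (~: [set i0])).
  - exact: enum_uniq.
  - by rewrite mem_enum !inE eqxx.
  move=> t [u [injt ui0 us _ ci]].
  have sE i : (i \in enum (~: [set i0])) = (i != i0) by rewrite mem_enum !inE.
  have sz : size (enum (~: [set i0])) = n.-1.
    by rewrite -cardE cardsC1 card_ord.
  have [x xt _] := moment_comb_avoid f [::] (codom t).
  exists i0, (fun i => if i == i0 then x else t i), u; split=> //.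
  - move=> i j; case: (eqVneq i i0) (eqVneq j i0) => [->|ii0] [->|ji0] //.
    + by move=> xE; case/negP: xt; rewrite xE codom_f.
    + by move=> xE; case/negP: xt; rewrite -xE codom_f.
    + by apply: injt; rewrite sE.
  - by move=> i ii0; rewrite (negPf ii0) us // sE.
  - rewrite sz in ci; congr (complete_intersection _ _ _ _): ci.
    by apply: boolp.funext => i; rewrite sE; case: eqP.
elim=> [_ _|i s IH].
  exists (fun=> 0), (exch (fun i => 'X_i) i0 l).
  have ci0 : complete_intersection (exch (fun i => 'X_i) i0 l)
      (fun k => if k == i0 then 1%N else 1%N)
      (widen 1 (fun j => (j == 0)%N : nat)) (0 + 1).-1.
    apply: (ci_exch ci_vars _ hl) => // p zp; rewrite evXU => pi0.
    rewrite (linear_formE hl) ev_sum (bigD1 i0) //= big1 ?addr0 => [|k ki0].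
      by rewrite evZ evXU pi0 mulr1; apply/eqP.
    by rewrite evZ zp ?mulr0.
  split=> //; first by rewrite /exch eqxx.
    by move=> k; rewrite inE /exch => /negPf ->.
  rewrite widen1 in ci0; congr (complete_intersection _ _ _ _): ci0.
  by apply: boolp.funext => k; rewrite if_same.
rewrite /= inE negb_or => /andP[is_ us] /andP[i0i i0s].
have [t [u [injt ui0 us' ux ci]]] := IH us i0s.
set I := gen u (~: [set i]).
have [hu dg0 su H h0 soc] := ci.
have hI : homog_ideal I := homog_ideal_gen _ hu.
have uiX : u i = 'X_i by apply: ux; rewrite inE negb_or eq_sym i0i.
have hv : u i \is 1.-homog by rewrite uiX dhomogX /= mdeg1.
have nzv : nzd I (u i) by apply: su; rewrite !inE eqxx.
have H' := hilbert_ext (gen_setT u i) H.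
have qD := quot_dim_dehomog hI hv H' h0 nzv (leqnn _).
have [r rP] := finite_points (ideal_adjoin _ (proj1 hI)) qD.
have [x xbad xr] := moment_comb_avoid f r (map t s).
exists (fun k => if k == i then x else t k), (exch u i (moment_comb f x)).
split.
- move=> j k; rewrite !inE.
  case: (eqVneq j i) (eqVneq k i) => [->|ji] [->|ki] //= js ks.
  + by move=> xE; case/negP: xbad; rewrite xE map_f.
  + by move=> xE; case/negP: xbad; rewrite -xE map_f.
  + exact: injt.
- by rewrite /exch (negPf i0i).
- move=> k; rewrite inE /exch; case: eqP => //= _; exact: us'.
- move=> k; rewrite !inE !negb_or /exch => /and3P[k0 ki ks].
  by rewrite (negPf ki) ux // inE negb_or k0.
have di : (if i \in s then e else 1%N) = 1%N by rewrite (negPf is_).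
have := ci_exch ci di (hw x) e0.
have -> : (size s * e.-1 + e).-1 = ((size s).+1 * e.-1)%N.
  by rewrite mulSn; case: (e) e0 => // e' _; rewrite addnS /= addnC.
have -> : (fun k => if k == i then e else if k \in s then e else 1%N) =
          (fun k => if k \in i :: s then e else 1%N).
  by apply: boolp.funext => k; rewrite inE; case: eqP.
apply=> p zp pi1.
apply/eqP; apply: xr; last first.
  apply: pts; last by rewrite -ui0; apply: zp.
  by apply/eqP => p0; move: pi1; rewrite uiX evXU p0 mxE => /esym/eqP; rewrite oner_eq0.
apply: rP => q [b Ib].
have : vanish p (q - b * (u i - 1)).
  apply: gen_sub Ib; first exact: ideal_vanish.
  by move=> k; rewrite !inE => ki; apply: zp.
by rewrite /vanish evB evM evB ev1 pi1 subrr mulr0 subr0.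
Qed.

End ClosedPoints.

(** * Derivatives and homogeneity *)

Section Derivatives.
Variables (K : fieldType) (n : nat).
Local Notation R := {mpoly K[n]}.
Implicit Types (p : 'rV[K]_n) (f : R).

Lemma mderivXU (i j : 'I_n) : ('X_j : R)^`M(i) = (j == i)%:R.
Proof.
rewrite mderivX mnm1E; case: eqP => [->|_]; last by rewrite scale0r.
rewrite scale1r; have -> : (U_(i) - U_(i) = 0)%MM; last exact: mpolyX0.
by apply/mnmP => k; rewrite mnmBE subnn mnm0E.
Qed.

Lemma homog_mderiv f d i : f \is d.-homog -> f^`M(i) \is d.-1.-homog.
Proof.
move=> /dhomogP hf; apply/dhomogP => m.
rewrite mcoeff_msupp mcoeff_mderiv => h.
have /hf /= : (m + U_(i))%MM \in msupp f.
  by rewrite mcoeff_msupp; apply: contraNneq h => ->; rewrite mul0rn.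
by rewrite mdegD mdeg1 => <-; rewrite addn1.
Qed.

Lemma mderiv2_homog_small f d i j : f \is d.-homog -> (d <= 1)%N ->
  f^`M(i)^`M(j) = 0.
Proof.
move=> hf d1; apply/mpolyP => m; rewrite !mcoeff_mderiv mcoeff0.
rewrite (dhomog_nemf_coeff hf) ?mul0rn //= !mdegD !mdeg1.
by apply/eqP; lia.
Qed.

Lemma ev_scale f d c p : f \is d.-homog -> ev (c *: p) f = c ^+ d * ev p f.
Proof.
move=> /dhomogP hf; rewrite /ev !mevalE mulr_sumr.
rewrite big_seq [RHS]big_seq; apply: eq_bigr => m /hf /= <-.
rewrite mulrCA; congr (_ * _); rewrite mdegE -prodrXr -big_split.
by apply: eq_bigr => i _; rewrite mxE exprMn.
Qed.

Lemma euler f d : f \is d.-homog -> \sum_i 'X_i * f^`M(i) = d%:R *: f.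
Proof.
move=> /dhomogP hf; rewrite [X in _ = _ *: X]mpolyE scaler_sumr.
under eq_bigr do rewrite {1}[f]mpolyE raddf_sum mulr_sumr.
rewrite exchange_big /= big_seq [RHS]big_seq; apply: eq_bigr => m /hf /= <-.
rewrite mdegE natr_sum scaler_suml; apply: eq_bigr => i _.
rewrite mderivZ mderivX -!scalerAr scalerA [RHS]scalerA mulrC.
case: (posnP (m i)) => [->|mi]; first by rewrite mul0r !scale0r.
congr (_ *: _); rewrite -mpolyXD; congr 'X_[_].
by rewrite addmC submK // lep1mP -lt0n.
Qed.

Lemma ev_euler f d p : f \is d.-homog ->
  \sum_i p 0 i * ev p f^`M(i) = d%:R * ev p f.
Proof.
move=> /euler/(congr1 (ev p)); rewrite evZ ev_sum => <-.
by apply: eq_bigr => i _; rewrite evM evXU.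
Qed.

End Derivatives.

(** * Non-degenerate zeros of ideals *)

Section Nondegenerate.
Variables (K : fieldType) (n : nat).
Local Notation R := {mpoly K[n]}.

(** Where the Jacobian matrix of functions of an ideal is injective, they
    generate the maximal ideal of the local ring: they are linear combinations
    of the X_k - p_k, and Cramer's rule inverts the coefficient matrix up to
    its determinant. *)
Lemma local_maximal_ideal r (g : 'I_r -> R) (p : 'rV[K]_n)
    (L : 'M[K]_(n, r)) (Q : R -> Prop) : ideal Q ->
  (forall i, Q (g i)) -> (forall i, ev p (g i) = 0) ->
  L *m \matrix_(i, k) ev p (g i)^`M(k) = 1%:M ->
  exists2 delta, ev p delta != 0 & forall k, Q (delta * ('X_k - (p 0 k)%:MP)).
Proof.
move=> idQ Qg g0 LJ.
have /fin_all_exists[c cE] i := hadamard p (g i).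
have dc i k : ev p (g i)^`M(k) = ev p (c i k).
  rewrite cE g0 mpolyC0 add0r raddf_sum ev_sum (bigD1 k) //=.
  rewrite big1 ?addr0 => [|j jk]; rewrite mderivM mderivB mderivXU mderivC subr0 evD !evM.
    by rewrite evB evXU evC subrr mulr0 add0r eqxx ev1 mulr1.
  by rewrite (negPf jk) ev0 evB evXU evC subrr !mulr0 addr0.
pose C := \matrix_(i < r, k < n) c i k.
pose T := map_mx (@mpolyC n K) L *m C.
pose y := \col_k ('X_k - (p 0 k)%:MP : R).
have Ty i : Q ((T *m y) i 0).
  rewrite -mulmxA mxE; apply: ideal_sum => // j _; apply: idealM => //.
  suff -> : (C *m y) j 0 = g j by [].
  rewrite cE g0 mpolyC0 add0r mxE; apply: eq_bigr => k _; by rewrite !mxE.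
exists (\det T) => [|k].
  suff -> : ev p (\det T) = 1 by apply: oner_neq0.
  have -> : ev p (\det T) = \det (map_mx (ev p) T).
    rewrite /determinant ev_sum; apply: eq_bigr => s _.
    rewrite evM [ev p (\prod_i _)]rmorph_prod; congr (_ * _).
      by rewrite evX; congr (_ ^+ _); rewrite -[X in ev p X]sub0r evB ev0 ev1 sub0r.
    by apply: eq_bigr => i _; rewrite [RHS]mxE.
  rewrite -(det1 K n) -LJ; congr (\det _); apply/matrixP => i k.
  rewrite !mxE ev_sum; apply: eq_bigr => j _.
  by rewrite evM !mxE evC dc.
suff -> : \det T * ('X_k - (p 0 k)%:MP) = (\adj T *m (T *m y)) k 0.
  by rewrite mxE; apply: ideal_sum => // j _; apply: idealM.
by rewrite mulmxA mul_adj_mx mul_scalar_mx !mxE.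
Qed.

End Nondegenerate.

Section ReducedPoints.
Variables (K : numClosedFieldType) (n : nat).
Local Notation R := {mpoly K[n]}.

(** A joint eigenvector of the variables in the quotient of the ideal of the
    z_i by Q sits at some z_i, where it is killed by the local unit delta. *)
Lemma reduced_points (Q : R -> Prop) D s (z : 'I_s -> 'rV[K]_n) : ideal Q ->
  quot_dim (fun=> True) Q D ->
  (forall q i, Q q -> ev (z i) q = 0) ->
  (forall p, (forall q, Q q -> ev p q = 0) -> exists i, p = z i) ->
  (forall i, exists2 delta, ev (z i) delta != 0 &
     forall k, Q (delta * ('X_k - (z i 0 k)%:MP))) ->
  forall a, (forall i, ev (z i) a = 0) -> Q a.
Proof.
move=> idQ qQ Qz zQ dz.
pose P (a : R) := forall i, ev (z i) a = 0.
have idP : ideal P.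
  split=> [i|x y Px Py i|c x Px i]; first exact: ev0.
    by rewrite evD Px Py addr0.
  by rewrite evM Px mulr0.
have [||||| m1 [m2 [_ qPQ _]]] := quot_dim_split (A := fun=> True)
  (B := P) (C := Q) _ _ _ _ _ qQ; try by [].
- exact: subspace_ideal.
- exact: subspace_ideal.
- by move=> x _ Qx i; apply: Qz.
case: m2 qPQ => [/quot_dim0 //|m2 qPQ].
have [p [b [Pb nQb hb]]] := point_of_quot idQ idP qPQ isT.
have zb := point_vanish idQ nQb hb.
have [q Qq|i pE] := zQ p; first by apply: zb; apply: idealMr.
have [delta d0 Qd] := dz i; case/eqP: d0; rewrite -pE; apply: zb.
have [c cE] := hadamard p b.
rewrite cE {1}pE Pb mpolyC0 add0r mulr_sumr; apply: ideal_sum => // k _.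
by rewrite mulrCA; apply: idealM => //; rewrite pE; apply: Qd.
Qed.

End ReducedPoints.

(** * Ordinary double points *)

Section TjurinaNumber.
Variables (K : fieldType) (m : nat).
Local Notation R := {mpoly K[m]}.
Implicit Types (p : 'rV[K]_m) (h : R) (x y : ratfun K m).

Lemma rfD (a b : R) : rf (a + b) = rf a + rf b. Proof. exact: rmorphD. Qed.
Lemma rfB (a b : R) : rf (a - b) = rf a - rf b. Proof. exact: rmorphB. Qed.
Lemma rfM (a b : R) : rf (a * b) = rf a * rf b. Proof. exact: rmorphM. Qed.
Lemma rf1 : rf (1 : R) = 1. Proof. exact: rmorph1. Qed.
Lemma rf_eq0 (a : R) : (rf a == 0) = (a == 0). Proof. exact: tofrac_eq0. Qed.

Lemma ev_neq0 p (b : R) : ev p b != 0 -> rf b != 0.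
Proof. by apply: contraNneq => /eqP; rewrite rf_eq0 => /eqP ->; rewrite ev0. Qed.

Lemma scale_ratfun (c : K) x : c *: x = rf c%:MP * x. Proof. by []. Qed.

Lemma local_ringD p x y : local_ring p x -> local_ring p y -> local_ring p (x + y).
Proof.
move=> [a [b [b0 ->]]] [a' [b' [b'0 ->]]].
exists (a * b' + a' * b), (b * b'); rewrite evM mulf_neq0 //; split=> //.
by rewrite rfD !rfM addf_div //; apply: ev_neq0; eassumption.
Qed.

Lemma local_ringM p x y : local_ring p x -> local_ring p y -> local_ring p (x * y).
Proof.
move=> [a [b [b0 ->]]] [a' [b' [b'0 ->]]].
exists (a * a'), (b * b'); rewrite evM mulf_neq0 //; split=> //.
by rewrite !rfM mulf_div.
Qed.

Lemma local_ring_poly p (a : R) : local_ring p (rf a).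
Proof. by exists a, 1; rewrite ev1 oner_eq0 rf1 divr1. Qed.

Lemma subspace_tjurina_ideal h p : subspace (tjurina_ideal h p).
Proof.
split=> [|c x y [b0 [b [lb0 lb ->]]] [c0 [d [lc0 ld ->]]]].
  have l0 : local_ring p (0 : ratfun K m).
    by rewrite -(rmorph0 (@tofrac _)); apply: local_ring_poly.
  by exists 0, (fun=> 0); split=> //; rewrite mul0r big1 ?addr0 // => i _; rewrite mul0r.
exists (c *: b0 + c0), (fun i => c *: b i + d i); split=> [|i|].
- by apply: local_ringD => //; apply: local_ringM => //; apply: local_ring_poly.
- by apply: local_ringD => //; apply: local_ringM => //; apply: local_ring_poly.
rewrite !scale_ratfun mulrDr mulrA addrACA -mulrDl mulr_sumr -big_split.
by congr (_ + _); apply: eq_bigr => i _; rewrite mulrDl mulrA.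
Qed.

Definition local_max p x : Prop :=
  exists a b : R, [/\ ev p b != 0, ev p a = 0 & x = rf a / rf b].

Lemma local_maxD p x y : local_max p x -> local_max p y -> local_max p (x + y).
Proof.
move=> [a [b [b0 a0 ->]]] [a' [b' [b'0 a'0 ->]]].
exists (a * b' + a' * b), (b * b'); rewrite !(evD, evM) mulf_neq0 //.
rewrite a0 a'0 !mul0r addr0; split=> //.
by rewrite rfD !rfM addf_div //; apply: ev_neq0; eassumption.
Qed.

Lemma local_maxM p x (a : R) : local_ring p x -> ev p a = 0 -> local_max p (x * rf a).
Proof.
move=> [a' [b' [b'0 ->]]] a0; exists (a' * a), b'; rewrite evM a0 mulr0.
by split=> //; rewrite rfM mulrAC.
Qed.

(** The derivatives of h generate the maximal ideal of the local ring, so the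
    quotient is the residue field. *)
Lemma tjurina_nondeg h p : ev p h = 0 -> nondeg_crit h p ->
  quot_dim (local_ring p) (tjurina_ideal h p) 1.
Proof.
move=> h0 [dh0 unitH].
have [||||delta d0 dQ] := @local_maximal_ideal K m m (fun i => h^`M(i)) p
  (invmx (\matrix_(i < m, j < m) ev p h^`M(i)^`M(j)))
  (gen (fun i => h^`M(i)) setT).
- exact: ideal_gen.
- by move=> i; apply: (gen_mem (fun i => h^`M(i))).
- by [].
- exact: mulVmx.
exists (fun=> 1); split=> [_|x [a [b [b0 ->]]]|c].
- by rewrite -rf1; apply: local_ring_poly.
- pose k := ev p a / ev p b; exists (fun=> k).
  rewrite big_ord1 scale_ratfun mulr1.
  pose N := a - k%:MP * b.
  have N0 : ev p N = 0 by rewrite evB evM evC divfK ?subrr.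
  have : gen (fun i => h^`M(i)) setT (delta * N).
    have [c cE] := hadamard p N.
    rewrite cE N0 mpolyC0 add0r mulr_sumr; apply: ideal_sum => [|i _].
      exact: ideal_gen.
    by rewrite mulrCA; apply: idealM => //; apply: ideal_gen.
  case=> c cE.
  have rb := ev_neq0 b0; have rd := ev_neq0 d0.
  exists 0, (fun i => rf (c i) / (rf delta * rf b)); split=> [|i|].
  + by rewrite -(rmorph0 (@tofrac _)); apply: local_ring_poly.
  + by exists (c i), (delta * b); rewrite evM mulf_neq0 ?rfM.
  + have -> : \sum_i rf (c i) / (rf delta * rf b) * rf h^`M(i) =
      rf (\sum_(i in setT) c i * h^`M(i)) / (rf delta * rf b).
      rewrite [rf (\sum_(i in _) _)]rmorph_sum mulr_suml.
      apply: eq_big => [i|i _]; first by rewrite inE.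
      by rewrite [LHS]mulrAC; congr (_ / _); rewrite -rfM.
    have frac (u y w : ratfun K m) : y != 0 -> u / y - w = (u - w * y) / y.
      by move=> y0; rewrite mulrBl mulfK.
    rewrite -cE mul0r add0r rfM -mulf_div divff // mul1r rfB rfM.
    exact: frac.
- rewrite big_ord1 scale_ratfun mulr1 => tj i; rewrite ord1.
  have [a [b [b0 a0 E]]] : local_max p (rf (c ord0)%:MP).
    move: tj => [c0 [d [lc0 ld ->]]]; apply: local_maxD.
      exact: local_maxM.
    elim/big_rec: _ => [|j x _ mx]; last by apply: local_maxD => //; apply: local_maxM.
    by exists 0, 1; rewrite ev1 ev0 oner_eq0 rf1 divr1 /rf rmorph0.
  have : rf ((c ord0)%:MP * b) = rf a by rewrite rfM E divfK // (ev_neq0 b0).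
  move/eqP; rewrite -subr_eq0 -rfB rf_eq0 subr_eq0 => /eqP/(congr1 (ev p)).
  by rewrite evM evC a0 => /eqP; rewrite mulf_eq0 (negPf b0) orbF => /eqP.
Qed.

End TjurinaNumber.

Section Nodes.
Variables (K : numClosedFieldType) (n : nat).
Local Notation R := {mpoly K[n]}.
Implicit Types (f : R) (v : 'rV[K]_n).

Lemma mderiv_dehom i f k : (dehom i f)^`M(k) = dehom i f^`M(lift i k).
Proof.
elim/mpoly_alg_ind: f => [c|j|x y hx hy|x y hx hy].
- by rewrite /dehom comp_mpolyC !mderivC comp_mpoly0.
- rewrite /dehom comp_mpolyXU -tnth_nth tnth_mktuple mderivXU.
  rewrite rmorph_nat; case: unliftP => [l ->|->].
    by rewrite mderivXU (inj_eq lift_inj).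
  by rewrite -mpolyC1 mderivC (negPf (neq_lift _ _)).
- by rewrite /dehom !(comp_mpolyD, mderivD) -!/(dehom _ _) hx hy.
- rewrite {1}/dehom rmorphM /= mderivM -!/(dehom _ _) hx hy.
  by rewrite mderivM /dehom comp_mpolyD !rmorphM.
Qed.

Lemma ev_dehom i f v : v 0 i != 0 ->
  ev (chart_pt i v) (dehom i f) = ev ((v 0 i)^-1 *: v) f.
Proof.
move=> vi; rewrite /ev comp_mpoly_meval; apply: meval_eq => j.
rewrite tnth_mktuple; case: unliftP => [k ->|->].
  by rewrite mevalXU !mxE mulrC.
by rewrite meval1 !mxE mulVf.
Qed.

(** By Euler's formula for the partial derivatives, v is in the kernel of the
    Hessian matrix at v; removing row and column i gives, up to a scalar, the
    invertible Hessian matrix of the equation in the chart x_i <> 0. *)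
Lemma odp_hessian f d v : f \is d.-homog -> proj_sing f v ->
  ordinary_double_point f v ->
  forall x : 'I_n -> K, (forall k, \sum_j ev v f^`M(k)^`M(j) * x j = 0) ->
  exists c, forall j, x j = c * v 0 j.
Proof.
move=> hf [v0 fv Sv] odp x Hx.
have [i vi] : exists i, v 0 i != 0.
  by apply/rV0Pn.
have [_ [_ unitH]] := odp i vi.
pose c := x i / v 0 i; exists c => j.
pose y j := x j - c * v 0 j.
have yi : y i = 0 by rewrite /y /c divfK ?subrr.
have hd k := homog_mderiv k hf; have hdd k l := homog_mderiv l (hd k).
have Hy k : \sum_j ev v f^`M(k)^`M(j) * y j = 0.
  under eq_bigr do rewrite mulrBr mulrCA [_ * v _ _]mulrC.
  by rewrite sumrB Hx -mulr_sumr (ev_euler _ (hd k)) Sv !mulr0 subr0.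
pose H := \matrix_(k < n.-1, l < n.-1)
  ev (chart_pt i v) (dehom i f)^`M(k)^`M(l).
have HE k l : H k l = (v 0 i)^-1 ^+ d.-1.-1 * ev v f^`M(lift i k)^`M(lift i l).
  by rewrite mxE !mderiv_dehom ev_dehom // (ev_scale _ _ (hdd _ _)).
have Hyl : H *m \col_l y (lift i l) = 0.
  apply/colP => k; rewrite [LHS]mxE mxE.
  under eq_bigr do rewrite HE mxE -mulrA.
  rewrite -mulr_sumr; have := Hy (lift i k).
  by rewrite (@bigD1_ord _ _ _ _ i) //= yi mulr0 add0r => ->; rewrite mulr0.
have yl : \col_l y (lift i l) = 0.
  by rewrite -[LHS]mul1mx -(mulVmx unitH) -mulmxA Hyl mulmx0.
apply/eqP; rewrite -subr_eq0; apply/eqP; rewrite -/(y j).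
case: (unliftP i j) => [l ->|->] //.
by have /colP/(_ l) := yl; rewrite !mxE.
Qed.

Lemma odp_scale f v c : c != 0 ->
  ordinary_double_point f v -> ordinary_double_point f (c *: v).
Proof.
move=> c0 odp i; rewrite mxE mulf_eq0 (negPf c0) /= => vi.
have -> : chart_pt i (c *: v) = chart_pt i v; last exact: odp.
by apply/rowP => k; rewrite !mxE -mulf_div divff ?mul1r.
Qed.

(** Representatives of the singular points inject into any other system. *)
Lemma sing_points_le f s s' (z : 'I_s -> 'rV[K]_n) (z' : 'I_s' -> 'rV[K]_n) :
  sing_points f z -> sing_points f z' -> (s <= s')%N.
Proof.
move=> [zs zi _] [_ _ zc'].
have /fin_all_exists[phi /fin_all_exists[c cE]] i := zc' _ (zs i).
rewrite -[s]card_ord -[s']card_ord; apply: (@leq_card _ _ phi) => i j ij.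
apply: (zi i j (c i / c j)); rewrite (cE j) scalerA.
have cj : c j != 0.
  by apply/eqP => cj0; case: (zs j) => /eqP[]; rewrite cE cj0 scale0r.
by rewrite divfK // (cE i) ij.
Qed.

Lemma total_tjurina_odp f s (z : 'I_s -> 'rV[K]_n) tau : sing_points f z ->
  (forall i, ordinary_double_point f (z i)) -> total_tjurina f tau -> tau = s.
Proof.
move=> zs odp [s' [z' [t [zs' tj ->]]]].
have <- : s' = s by apply/eqP; rewrite eqn_leq (sing_points_le zs' zs) (sing_points_le zs zs').
rewrite (eq_bigr (fun=> 1%N)) ?sum1_card ?card_ord // => j _.
have [zs'1 _ _] := zs'; have [_ _ zc] := zs.
have [v0 _ _] := zs'1 j.
have odp' : ordinary_double_point f (z' j).
  have [i [c cE]] := zc _ (zs'1 j); rewrite cE; apply: odp_scale => //.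
  by apply: contraNneq v0 => c0; rewrite cE c0 scale0r.
have /rV0Pn[k vk] := v0; have [h0 nd] := odp' k vk.
apply: quot_dim_uniq (tj j k vk) _; first exact: subspace_tjurina_ideal.
exact: tjurina_nondeg.
Qed.

End Nodes.

(** * The Jacobian algebra of a nodal hypersurface *)

Section AdjoinMore.
Variables (K : fieldType) (n : nat).
Local Notation R := {mpoly K[n]}.
Implicit Types (I : R -> Prop).

Lemma adjoinC I v w a : adjoin (adjoin I v) w a <-> adjoin (adjoin I w) v a.
Proof.
split=> -[b [c Ic]]; exists c, b;
  by rewrite addrAC.
Qed.

Definition order_ge k (p : R) : Prop := forall m, m \in msupp p -> (k <= mdeg m)%N.

Lemma order_geM k l p q : order_ge k p -> order_ge l q -> order_ge (k + l) (p * q).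
Proof.
move=> op oq m /msuppM_le/allpairsP[[m1 m2] /= [/op h1 /oq h2 ->]].
by rewrite mdegD leq_add.
Qed.

Lemma order_ge_irrelevant g : irrelevant g -> order_ge 1 g.
Proof.
move=> [c ->] m /msupp_sum_le/flattenP[_ /mapP[i _ ->]].
have /(@order_geM 0 1) : order_ge 0 (c i) by [].
apply=> m'; rewrite msuppX inE => /eqP ->; by rewrite mdeg1.
Qed.

Lemma order_ge_prod j (g : 'I_j -> R) :
  (forall i, irrelevant (g i)) -> order_ge j (\prod_i g i).
Proof.
elim: j g => [|j IH] g hg; first by [].
rewrite big_ord_recl; apply: (@order_geM 1 j); first exact: order_ge_irrelevant.
by apply: IH.
Qed.

Lemma ideal_order_ge I k : ideal I ->
  (forall j a, (k <= j)%N -> a \is j.-homog -> I a) -> forall p, order_ge k p -> I p.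
Proof.
move=> idI hI p op; rewrite (mpolyE p) big_seq.
elim/big_rec: _ => [|m x mp Ix]; first exact: ideal0.
apply: idealD => //; apply: idealZ => //; apply: hI (op m mp) _.
by rewrite dhomogX.
Qed.

End AdjoinMore.

Section NodalAlgebra.
Variables (K : numClosedFieldType) (n : nat).
Local Notation R := {mpoly K[n]}.
Variables (u : 'I_n -> R) (i0 : 'I_n) (e : nat) (h : nat -> nat) (T : nat).
Variables (g0 : R) (s : nat) (z : 'I_s -> 'rV[K]_n) (y : 'I_s -> R).

Local Notation l := (u i0).
Local Notation G := (gen u (~: [set i0])).
Local Notation J := (adjoin G g0).

Hypothesis s_gt0 : (0 < s)%N.
Hypothesis ci : complete_intersection u (fun i => if i == i0 then 1%N else e) h T.
Hypothesis hT : h T = 1%N.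
Hypothesis g0_homog : g0 \is e.-homog.
Hypothesis lz : forall i, ev (z i) l = 1.
Hypothesis Jz : forall q i, J q -> ev (z i) q = 0.
Hypothesis Jred : forall a, (forall i, ev (z i) a = 0) -> adjoin J (l - 1) a.
Hypothesis y_homog : forall i, y i \is 1.-homog.
Hypothesis yz : forall i k, ev (z k) (y i) = (i == k)%:R.

Let hG : homog_ideal G. Proof. exact: homog_ideal_gen (ci_homog ci). Qed.
Let idG : ideal G. Proof. by case: hG. Qed.
Let hl : l \is 1.-homog. Proof. by have := ci_homog ci i0; rewrite eqxx. Qed.
Let nzl : nzd G l. Proof. by apply: (ci_regular ci); rewrite !inE eqxx. Qed.
Let idJ : ideal J. Proof. exact: ideal_adjoin. Qed.
Let hJ : homog_ideal J. Proof. exact: homog_ideal_adjoin g0_homog. Qed.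
Let hilbB : hilbert (adjoin G l) h.
Proof. exact: hilbert_ext (gen_setT u i0) (ci_hilbert ci). Qed.

Definition hilb_sum (j : nat) : nat := (\sum_(i < j.+1) h i)%N.

Let hilbA : hilbert G hilb_sum.
Proof. exact: hilbert_of_adjoin hG hl nzl hilbB. Qed.

Local Notation Q := (adjoin G (l - 1)).
Let idQ : ideal Q. Proof. exact: ideal_adjoin. Qed.

Let dimQ : quot_dim (fun=> True) Q (hilb_sum T).
Proof. exact: quot_dim_dehomog hG hl hilbB (ci_top ci) _ nzl (leqnn T). Qed.

Let Qz q i : adjoin J (l - 1) q -> ev (z i) q = 0.
Proof.
by move=> [b Jb]; have := Jz i Jb; rewrite evB evM evB lz ev1 subrr mulr0 subr0.
Qed.

Let dimQJ : quot_dim (fun=> True) (adjoin Q g0) s.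
Proof.
exists y; split=> // [a _|c /adjoinC Qc k].
  exists (fun i => ev (z i) a); apply/adjoinC/Jred => k.
  rewrite evB ev_sum (bigD1 k) //= big1 => [|i ik]; rewrite evZ yz.
    by rewrite eqxx mulr1 addr0 subrr.
  by rewrite (negPf ik) mulr0.
have := Qz k Qc; rewrite ev_sum (bigD1 k) //= big1 => [|i ik]; rewrite evZ yz.
  by rewrite eqxx mulr1 addr0.
by rewrite (negPf ik) mulr0.
Qed.

(** W / G is the annihilator of g0 in R / G; it computes the first Koszul homology
    of the generators of G together with g0. *)
Local Notation W := (fun a : R => G (g0 * a)).
Let idW : ideal W. Proof. exact: ideal_quot. Qed.

(** Kernel and cokernel of g0 on the finite dimensional algebra R / Q have the
    same dimension, and the cokernel is the algebra of functions on the nodes. *)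
Let dim_kernel : quot_dim (fun a : R => Q (g0 * a)) Q s.
Proof.
have idKr : ideal (fun a : R => Q (g0 * a)) by apply: ideal_quot.
have idQ' : ideal (adjoin Q g0) by apply: ideal_adjoin.
have sT : subspace (fun _ : R => True) by [].
have [||m1 [m2 [q1 q2 D12]]] := quot_dim_split sT (subspace_ideal idKr)
  (subspace_ideal idQ) _ _ dimQ; first by [].
  by move=> x _; apply: idealM.
have [||m3 [m4 [q3 q4 D34]]] := quot_dim_split sT (subspace_ideal idQ')
  (subspace_ideal idQ) _ _ dimQ; first by [].
  by move=> x _; apply: adjoinS.
have m3E : m3 = s := quot_dim_uniq (subspace_ideal idQ') q3 dimQJ.
have q4' : quot_dim (adjoin Q g0) Q m1.
  apply: (@quot_dim_map _ _ _ ( *%R g0) _ (fun=> True)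
            (fun a : R => Q (g0 * a))) q1 => //.
  - by move=> c a b; rewrite mulrDr -scalerAr.
  - exact: subspace_ideal.
  - by move=> a _; rewrite mulrC; apply: adjoinv.
  - by move=> a [b Qb]; exists b => //; rewrite mulrC.
have m4E := quot_dim_uniq (subspace_ideal idQ) q4 q4'.
suff <- : m2 = s by [].
lia.
Qed.

(** In degrees at least T, homogeneous classes of R / G correspond to classes of
    R / Q, and W to the kernel of g0. *)
Let dimW_top j : (T <= j)%N -> quot_dim (homog_in j W) G s.
Proof.
move=> le_Tj; have sW := subspace_homog_in j idW.
apply: (@quot_dim_comap _ _ _ id _ (homog_in j W) G _ Q) dim_kernel => //.
- exact: subspace_ideal.
- by move=> a [ha Wa]; apply: adjoinS.
- by move=> a [ha _]; apply: iff_sym; apply: dehomog_nzd ha.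
move=> a Ka; have [b hb Qab] := dehomog_onto hG hl hilbB (ci_top ci) a le_Tj.
exists b => //; split=> //.
have hgb : g0 * b \is (e + j).-homog by apply: dhomogM.
apply/(dehomog_nzd hG hl nzl hgb).
have -> : g0 * b = g0 * a - g0 * (a - b) by ring.
by apply: idealB => //; apply: idealM.
Qed.

(** A form c vanishing at the nodes lies in J + (l - 1), and J kills W / G. *)
Let W_points j k a c : homog_in j W a -> c \is k.-homog ->
  (forall i, ev (z i) c = 0) -> G (c * a).
Proof.
move=> [ha Wa] hc /Jred/adjoinC[b Qb].
have hca : c * a \is (k + j).-homog by apply: dhomogM.
apply/(dehomog_nzd hG hl nzl hca).
have -> : c * a = a * (c - b * g0) + b * (g0 * a) by ring.
by apply: idealD => //; [apply: idealM | apply: idealM => //; apply: adjoinS].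
Qed.

Let soc_l j a : a \is j.-homog -> (j < T)%N ->
  (forall k, adjoin G l ('X_k * a)) ->
  G a \/ exists2 b, (0 < j)%N /\ b \is j.-1.-homog & G (a - b * l).
Proof.
move=> ha lt_jT Ga.
have : adjoin G l a.
  apply/(gen_setT u i0)/(ci_socle ci ha) => [|k]; first by move: lt_jT; lia.
  exact/(gen_setT u i0).
by case/(adjoin_homog hG hl ha); [left|rewrite subn1; right].
Qed.

Let node_soc i a :
  (forall x, x \is 1.-homog -> ev (z i) x = 0 -> G (x * a)) ->
  forall k, adjoin G l ('X_k * a).
Proof.
move=> Ga k; set x := 'X_k - z i 0 k *: l.
have -> : 'X_k * a = x * a + (z i 0 k *: a) * l.
  by rewrite /x -!mul_mpolyC; ring.
apply: idealD; [exact: ideal_adjoin| |exact: adjoinv].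
apply: adjoinS; apply: Ga; first by rewrite rpredB ?rpredZ // dhomogX /= mdeg1.
by rewrite evB evZ lz evXU mulr1 subrr.
Qed.

(** A class of degree less than T supported at a single node would, after
    division by the highest possible power of l, give a socle element of the
    Gorenstein algebra R / (G + (l)) below its socle degree T. *)
Let single_node i j a : a \is j.-homog -> (j < T)%N ->
  (forall x, x \is 1.-homog -> ev (z i) x = 0 -> G (x * a)) -> G a.
Proof.
elim: j a => [|j IH] a ha lt_jT Ga.
  by case: (soc_l ha lt_jT (node_soc Ga)) => // -[b []].
case: (soc_l ha lt_jT (node_soc Ga)) => //.
move=> [b [_ hb] Gb]; apply/(ideal_eqmod idG Gb); apply: idealMr => //.
apply: IH hb (ltnW lt_jT) _ => x hx x0; apply: nzl.
have -> : l * (x * b) = x * a - x * (a - b * l) by ring.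
by apply: idealB; [|exact: Ga|apply: idealM].
Qed.

Let W_dual j a : homog_in j W a -> (forall i, G (y i * a)) -> G a.
Proof.
move=> Wa Gy; apply: nzl.
have -> : l * a = (l - \sum_i y i) * a + \sum_i y i * a.
  by rewrite -mulr_suml mulrBl subrK.
apply: idealD; [by []| |exact: ideal_sum].
apply: (W_points Wa (k := 1)) => [|k].
  apply: rpredB; first exact: hl.
  by apply: rpred_sum => i _; apply: y_homog.
rewrite evB lz ev_sum (bigD1 k) //= big1 => [|i ik]; rewrite yz.
  by rewrite eqxx addr0 subrr.
by rewrite (negPf ik).
Qed.

Let W_node j a i x : homog_in j W a -> x \is 1.-homog -> ev (z i) x = 0 ->
  G (x * (y i * a)).
Proof.
move=> Wa hx x0; rewrite mulrA; apply: (W_points Wa (k := (1 + 1)%N)) => [|k].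
  exact: dhomogM.
rewrite evM yz; case: eqP => [<-|_]; last by rewrite mulr0.
by rewrite x0 mul0r.
Qed.

(** Since y i vanishes at the nodes other than z i, the class of y i * a is
    supported at z i only. *)
Let W_low j a : (j.+1 < T)%N -> homog_in j W a -> G a.
Proof.
move=> lt_jT Wa; apply: (W_dual Wa) => i.
apply: (@single_node i j.+1) => // [|x hx x0].
  by rewrite -add1n; apply: dhomogM; [|case: Wa].
exact: W_node Wa hx x0.
Qed.

(** Multiplication by l embeds W / G in degree T - 1 into degree T, where the
    dimension is s. The codimension is at most 1, the dimension of R / (G + (l)) in
    degree T. If it were 0, every y i * a with a in W of degree T - 1 would be
    divisible by l, with a quotient supported at a single node. *)
Let dimW_mid j : j.+1 = T -> quot_dim (homog_in j W) G (s - 1).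
Proof.
move=> jT; pose B a := W a /\ adjoin G l a.
have idB : ideal B.
  have idA := ideal_adjoin l idG.
  split; [|move=> a b [Wa Aa] [Wb Ab]|move=> c a [Wa Aa]].
  - by split; [apply: (ideal0 idW) | apply: (ideal0 idA)].
  - by split; [apply: (idealD idW) | apply: (idealD idA)].
  - by split; [apply: (idealM idW) | apply: (idealM idA)].
have sWT := subspace_homog_in T idW; have sBT := subspace_homog_in T idB.
have sG := subspace_ideal idG.
have [||m1 [m2 [q1 q2 sE]]] := quot_dim_split sWT sBT sG _ _ (dimW_top (leqnn T)).
- by move=> x [hx []].
- by move=> x [hx Wx] Gx; split=> //; split=> //; apply: adjoinS.
have qW : quot_dim (homog_in j W) G m2.
  apply: (@quot_dim_comap _ _ _ ( *%R l) _ (homog_in j W) G (homog_in T B) G) q2.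
  - by move=> c a b; rewrite mulrDr -scalerAr.
  - exact: subspace_homog_in.
  - by [].
  - move=> a [ha Wa]; split; first by rewrite -jT -add1n; apply: dhomogM.
    by split; [rewrite mulrCA; apply: idealM | rewrite mulrC; apply: adjoinv].
  - by move=> a _; split=> [|/nzl //]; apply: idealM.
  move=> a [ha [Wa Aa]].
  case: (adjoin_homog hG hl ha Aa) => [Ga|[b [_ hb] Gb]].
    exists 0; last by rewrite mulr0 subr0.
    by split; [apply: rpred0 | apply: (ideal0 idW)].
  exists b; last by rewrite mulrC.
  split; first by move: hb; rewrite -jT subn1.
  apply: nzl; have -> : l * (g0 * b) = g0 * a - g0 * (a - b * l) by ring.
  by apply: idealB => //; apply: idealM.
have m1_le1 : (m1 <= 1)%N.
  case: q1 => b [Wb _ ind]; rewrite -hT.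
  apply: (indep_mod_le (e := b) _ (hilbB T)).
    by apply: subspace_ideal; apply: ideal_adjoin.
  split=> [i|c Ac]; first by case: (Wb i).
  apply: ind; have [hc Wc] := subspace_comb c sWT Wb; by split.
have m1_gt0 : (0 < m1)%N.
  case: m1 q1 sE {m1_le1} => // /quot_dim0 WB sE.
  have [a Wa nGa] : exists2 a, homog_in j W a & ~ G a.
    apply: boolp.contrapT => no.
    suff m20 : m2 = 0%N by move: s_gt0; rewrite sE m20.
    apply: quot_dim_uniq sG qW _; apply/quot_dim0 => a Wa.
    by apply: boolp.contrapT => nGa; apply: no; exists a.
  case: nGa; apply: (W_dual Wa) => i.
  have hya : y i * a \is T.-homog.
    by rewrite -jT -add1n; apply: dhomogM; [|case: Wa].
  have [_ [_ Aya]] : homog_in T B (y i * a).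
    apply: WB; split=> //; rewrite mulrCA; apply: idealM => //; by case: Wa.
  case: (adjoin_homog hG hl hya Aya) => // -[b [_ hb] Gb].
  apply/(ideal_eqmod idG Gb); apply: idealMr => //.
  rewrite -jT subn1 /= in hb.
  apply: (single_node (i := i) hb); first by rewrite -jT.
  move=> x hx x0; apply: nzl.
  have -> : l * (x * b) = x * (y i * a) - x * (y i * a - b * l) by ring.
  by apply: idealB => //; [apply: W_node Wa hx x0 | apply: idealM].
suff -> : (s - 1)%N = m2 by [].
lia.
Qed.

Definition koszul_dim (j : nat) : nat :=
  if (j.+1 < T)%N then 0%N else if j.+1 == T then (s - 1)%N else s.

Lemma quot_dim_koszul j : quot_dim (homog_in j W) G (koszul_dim j).
Proof.
rewrite /koszul_dim; case: ltnP => [lt_jT|le_Tj].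
  by apply/quot_dim0 => a; apply: W_low.
case: eqP => [/dimW_mid //|jT]; apply: dimW_top.
by move: le_Tj jT; rewrite leq_eqVlt => /predU1P[->|].
Qed.

(** If T = 0, the forms of degree T are constants, which leaves room for a single node. *)
Lemma nodes_le1 : T = 0%N -> (s <= 1)%N.
Proof.
move=> T0; have [b [Wb _ ind]] := dimW_top (leqnn T).
have -> : 1%N = hilb_sum T by rewrite -hT /hilb_sum T0 big_ord1.
apply: (indep_mod_le (e := b) (subspace_ideal idG) (hilbA T)).
by split=> // i; case: (Wb i).
Qed.

Definition jacobian_dim (j : nat) : nat :=
  (hilb_sum j - (if e <= j then hilb_sum (j - e) - koszul_dim (j - e) else 0))%N.

Lemma quot_dim_colon j : (koszul_dim j <= hilb_sum j)%N /\
  quot_dim (homog_of j) W (hilb_sum j - koszul_dim j).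
Proof.
have sA : subspace (@homog_of K n j) by apply: subspace_homog_of.
have [||m1 [m2 [q1 q2 ->]]] := quot_dim_split sA (subspace_homog_in j idW)
   (subspace_ideal idG) _ _ (hilbA j).
- by move=> x [].
- by move=> x hx Gx; split=> //; apply: idealM.
have -> : koszul_dim j = m2.
  exact: quot_dim_uniq (subspace_ideal idG) (quot_dim_koszul j) q2.
rewrite leq_addl addnK; split=> //.
by apply: quot_dim_eq sA _ _ q1 => // a ha; split=> [[]|].
Qed.

Lemma quot_dim_jacobian j :
  quot_dim (homog_of j) J (jacobian_dim j) /\
  ((e <= j)%N -> (koszul_dim (j - e) <= hilb_sum (j - e) <= hilb_sum j + koszul_dim (j - e))%N).
Proof.
have [||le_m q] := quot_dim_mod_adjoin hG g0_homog (hilbA j)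
  (m' := if (e <= j)%N then (hilb_sum (j - e) - koszul_dim (j - e))%N else 0%N).
- by move=> i ->; rewrite leq_addl addnK; have [] := quot_dim_colon i.
- by case: leqP.
split=> // le_ej; rewrite le_ej in le_m; have [le_k _] := quot_dim_colon (j - e).
by rewrite le_k /=; move: le_m le_k; lia.
Qed.

(** ** The saturation of the Jacobian ideal *)

Definition at_nodes (a : R) : Prop := forall i, ev (z i) a = 0.

Lemma ideal_at_nodes : ideal at_nodes.
Proof.
split=> [i|a b a0 b0 i|c a a0 i]; first exact: ev0.
  by rewrite evD a0 b0 addr0.
by rewrite evM a0 mulr0.
Qed.

(** The forms vanishing at the nodes are those of the saturation of J. *)
Lemma at_nodesP j a : a \is j.-homog ->
  at_nodes a <-> exists N, J (l ^+ N * a).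
Proof.
move=> ha; split=> [/Jred/(dehomogP hJ hl ha)//|[N JN] i].
by have := Jz i JN; rewrite evM evX lz expr1n mul1r.
Qed.

Definition reduced_dim (j : nat) : nat := if j == 0%N then 1%N else s.

(** In positive degree, the forms y i * l^(j-1) separate the nodes. *)
Lemma quot_dim_at_nodes j : quot_dim (homog_of j) at_nodes (reduced_dim j).
Proof.
case: j => [|j]; rewrite /reduced_dim /=.
  exists (fun=> 1); split=> [_|a ha|c cz i].
  - exact: dhomog1.
  - exists (fun=> ev 0 a) => k; rewrite big_ord1 alg_mpolyC evB evC.
    have [c aE] : exists c, a = c%:MP.
      exists a@_0%MM; apply/mpolyP => m; rewrite mcoeffC.
      case: (eqVneq 0%MM m) => [<-|m0]; first by rewrite mulr1.
      rewrite (dhomog_nemf_coeff ha) ?mulr0 //=.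
      by rewrite mdeg_eq0 eq_sym.
    by rewrite aE !evC subrr.
  - by have := cz (Ordinal s_gt0); rewrite big_ord1 alg_mpolyC evC (ord1 i).
have yl i k : ev (z k) (y i * l ^+ j) = (i == k)%:R.
  by rewrite evM evX lz expr1n mulr1.
exists (fun i => y i * l ^+ j); split=> [i|a ha|c cz k].
- rewrite -add1n; apply: dhomogM => //.
  by have := dhomogMn j hl; rewrite mul1n.
- exists (fun i => ev (z i) a) => k.
  rewrite evB ev_sum (bigD1 k) //= big1 => [|i ik]; rewrite evZ yl.
    by rewrite eqxx mulr1 addr0 subrr.
  by rewrite (negPf ik) mulr0.
- have := cz k; rewrite ev_sum (bigD1 k) //= big1 => [|i ik]; rewrite evZ yl.
    by rewrite eqxx mulr1 addr0.
  by rewrite (negPf ik) mulr0.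
Qed.

Lemma quot_dim_torsion j :
  exists2 m, quot_dim (homog_in j at_nodes) J m &
    jacobian_dim j = (reduced_dim j + m)%N.
Proof.
have sA : subspace (@homog_of K n j) by apply: subspace_homog_of.
have sN := subspace_homog_in j ideal_at_nodes.
have [||m1 [m2 [q1 q2 E]]] := quot_dim_split sA sN (subspace_ideal idJ) _ _
  (proj1 (quot_dim_jacobian j)).
- by move=> x [].
- by move=> x hx Jx; split=> // i; apply: Jz.
exists m2 => //; rewrite E; congr (_ + _)%N.
apply: (quot_dim_uniq (subspace_ideal ideal_at_nodes)) (quot_dim_at_nodes j).
by apply: quot_dim_eq sA _ _ q1 => // a ha; split=> [[]|].
Qed.

Let power_l N k c : (T + N <= k)%N -> c \is k.-homog -> adjoin J (l ^+ N) c.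
Proof.
elim: N k c => [|N IH] k c; first by move=> _ _; exists c; rewrite mulr1 subrr; apply: ideal0.
rewrite addnS => lt_k hc.
have : adjoin G l c.
  have := hilbB k; rewrite (ci_top ci); last by apply: leq_ltn_trans lt_k; apply: leq_addr.
  by move/quot_dim0; apply.
case/(adjoin_homog hG hl hc) => [Gc|[b [_ hb] Gb]].
  by apply: adjoinS; apply: adjoinS.
have [|b' Jb'] := IH _ _ _ hb; first by rewrite subn1; case: (k) lt_k.
exists b'; have -> : c - b' * l ^+ N.+1 = (c - b * l) + (b - b' * l ^+ N) * l.
  by rewrite exprSr; ring.
by apply: idealD => //; [apply: adjoinS | apply: idealMr].
Qed.

(** R / (J + (l)) has finite length, so powers of the irrelevant ideal are
    contained in J + (l^N). *)
Lemma torsion_of_power N a : J (l ^+ N * a) ->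
  exists j0, forall j, (j0 <= j)%N ->
    forall g : 'I_j -> R, (forall i, irrelevant (g i)) -> J (\prod_i g i * a).
Proof.
move=> JN; exists (T + N)%N => j le_j g hg.
have [b Jb] : adjoin J (l ^+ N) (\prod_i g i).
  apply: (ideal_order_ge (k := T + N)); first exact: ideal_adjoin.
    exact: power_l.
  by move=> m /(order_ge_prod hg); apply: leq_trans.
have -> : \prod_i g i * a = (\prod_i g i - b * l ^+ N) * a + b * (l ^+ N * a) by ring.
by apply: idealD => //; [apply: idealMr | apply: idealM].
Qed.

End NodalAlgebra.

(** * Koszul relations *)

Section Koszul.
Variables (K : numClosedFieldType) (n : nat).
Local Notation R := {mpoly K[n]}.
Implicit Types (g f a : 'I_n -> R) (T : {set 'I_n}).

Definition koszul_on T g a : Prop := exists b : 'I_n -> 'I_n -> R,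
  (forall i j, b i j = - b j i) /\ forall i, i \in T -> a i = \sum_(j in T) b i j * g j.

Lemma antisym_diag (b : 'I_n -> 'I_n -> R) i : (forall i j, b i j = - b j i) -> b i i = 0.
Proof.
move=> /(_ i i) bb; have /eqP : b i i *+ 2 = 0 by rewrite mulr2n {1}bb addNr.
rewrite -scaler_nat => /eqP E; rewrite -[b i i]scale1r.
by rewrite -(mulVf (x := 2%:R : K)) ?pnatr_eq0 // -scalerA E scaler0.
Qed.

(** Once the last coefficient lies in the ideal of the other generators, a
    multiple of the Koszul relations removes it. *)
Lemma koszul_step T g k a : k \notin T ->
  (forall a, \sum_(i in T) a i * g i = 0 -> koszul_on T g a) ->
  \sum_(i in k |: T) a i * g i = 0 -> gen g T (a k) -> koszul_on (k |: T) g a.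
Proof.
move=> kT kos; rewrite big_setU1 //= => sum0 [c cE].
have [|b [anti bE]] := kos (fun i => a i + c i * g k).
  under eq_bigr do rewrite mulrDl.
  rewrite big_split /= -[RHS]sum0 addrC; congr (_ + _).
  by rewrite cE mulr_suml; apply: eq_bigr => i _; rewrite mulrAC.
have kE i : i \in T -> (i == k) = false by case: eqP => // ->; rewrite (negPf kT).
  exists (fun i j => if i == k then (if j == k then 0 else c j)
                     else if j == k then - c i else b i j); split.
    by move=> i j; case: (i == k); case: (j == k); rewrite ?oppr0 ?opprK.
  move=> i; rewrite in_setU1 => /predU1P[->|iT]; rewrite big_setU1 //= eqxx ?eqxx.
    rewrite mul0r add0r cE; apply: eq_bigr => j jT; by rewrite kE.
  rewrite kE // -[LHS](addrK (c i * g k)) bE // mulNr addrC; congr (_ + _).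
  by apply: eq_bigr => j jT; rewrite kE.
Qed.

Lemma koszul_regular T g a : strongly_regular g ->
  \sum_(i in T) a i * g i = 0 -> koszul_on T g a.
Proof.
move=> sg; have [m] := ubnP #|T|; elim: m T a => // m IH T a cT sum0.
have [->|[k kT]] := set_0Vmem T.
  by exists (fun _ _ => 0); split=> [|i]; rewrite ?oppr0 ?inE.
have knT : k \notin T :\ k by rewrite !inE eqxx.
rewrite -(setD1K kT); apply: koszul_step => //.
- by move=> a'; apply: IH; move: cT; rewrite (cardsD1 k) kT.
- by rewrite setD1K.
apply: (sg _ _ knT); move: sum0; rewrite (big_setD1 k) //= mulrC.
move/eqP; rewrite addr_eq0 => /eqP ->.
apply: idealN; [exact: ideal_gen|apply: ideal_sum; first exact: ideal_gen].
by move=> i iT; apply: idealM; [apply: ideal_gen | apply: gen_mem].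
Qed.

Definition koszul g a : Prop := koszul_on setT g a.

Lemma koszul_gen g a i : koszul g a -> gen g (~: [set i]) (a i).
Proof.
case=> b [anti bE]; rewrite (bE i) ?inE // (bigD1 i) ?inE //=.
rewrite antisym_diag // mul0r add0r; exists (b i).
by apply: eq_bigl => j; rewrite !inE.
Qed.

Section ChangeOfGenerators.
Variables (P : 'M[K]_n) (f g : 'I_n -> R).
Hypotheses (unitP : P \in unitmx) (gP : forall i, g i = \sum_j P i j *: f j).

Lemma gens_inv j : f j = \sum_i invmx P j i *: g i.
Proof.
under eq_bigr do rewrite gP scaler_sumr.
rewrite exchange_big /= (bigD1 j) //= [X in _ + X]big1 => [|k kj].
  rewrite addr0; under eq_bigr do rewrite scalerA.
  rewrite -scaler_suml; have /matrixP/(_ j j) := mulVmx unitP.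
  by rewrite !mxE eqxx => ->; rewrite scale1r.
under eq_bigr do rewrite scalerA.
rewrite -scaler_suml; have /matrixP/(_ j k) := mulVmx unitP.
by rewrite !mxE eq_sym (negPf kj) => ->; rewrite scale0r.
Qed.

(** Coefficients of the same linear combination with respect to g. *)
Definition new_coefs a : 'I_n -> R := fun i => \sum_j invmx P j i *: a j.
Definition old_coefs a : 'I_n -> R := fun j => \sum_i P i j *: a i.

Lemma new_coefsK a : new_coefs (old_coefs a) =1 a.
Proof.
move=> i; rewrite /new_coefs /old_coefs.
under eq_bigr do rewrite scaler_sumr.
rewrite exchange_big /= (bigD1 i) //= [X in _ + X]big1 => [|k ki].
  rewrite addr0; under eq_bigr do rewrite scalerA mulrC.
  rewrite -scaler_suml; have /matrixP/(_ i i) := mulmxV unitP.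
  by rewrite !mxE eqxx => ->; rewrite scale1r.
under eq_bigr do rewrite scalerA mulrC.
rewrite -scaler_suml; have /matrixP/(_ k i) := mulmxV unitP.
by rewrite !mxE (negPf ki) => ->; rewrite scale0r.
Qed.

Lemma sum_new_coefs a : \sum_i new_coefs a i * g i = \sum_j a j * f j.
Proof.
under [RHS]eq_bigr do rewrite gens_inv mulr_sumr.
rewrite exchange_big /=; apply: eq_bigr => i _; rewrite mulr_suml.
by apply: eq_bigr => j _; rewrite -scalerAl -scalerAr.
Qed.

Lemma koszul_new a : koszul f a <-> koszul g (new_coefs a).
Proof.
split=> -[b [anti bE]].
  exists (fun i l => \sum_j \sum_k (invmx P j i * invmx P k l) *: b j k); split.
    move=> i l; rewrite exchange_big /= -sumrN; apply: eq_bigr => k _.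
    rewrite -sumrN; apply: eq_bigr => j _.
    by rewrite anti scalerN mulrC.
  move=> i _; rewrite (eq_bigl predT); last by move=> l; rewrite inE.
  rewrite /new_coefs; under [LHS]eq_bigr do rewrite bE ?inE // scaler_sumr.
  under [RHS]eq_bigr do rewrite mulr_suml.
  rewrite [RHS]exchange_big /=; apply: eq_bigr => j _.
  rewrite (eq_bigl predT); last by move=> l; rewrite inE.
  under [RHS]eq_bigr do rewrite mulr_suml.
  rewrite [RHS]exchange_big /=; apply: eq_bigr => k _.
  rewrite (gens_inv k) mulr_sumr scaler_sumr; apply: eq_bigr => l _.
  by rewrite -scalerAr scalerA -scalerAl.
have aE j : a j = \sum_i P i j *: new_coefs a i.
  rewrite /new_coefs; under eq_bigr do rewrite scaler_sumr.
  rewrite exchange_big /= (bigD1 j) //= [X in _ + X]big1 => [|k kj].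
    rewrite addr0; under eq_bigr do rewrite scalerA mulrC.
    rewrite -scaler_suml; have /matrixP/(_ j j) := mulVmx unitP.
    by rewrite !mxE eqxx => ->; rewrite scale1r.
  under eq_bigr do rewrite scalerA mulrC.
  rewrite -scaler_suml; have /matrixP/(_ k j) := mulVmx unitP.
  by rewrite !mxE (negPf kj) => ->; rewrite scale0r.
exists (fun j k => \sum_i \sum_l (P i j * P l k) *: b i l); split.
  move=> j k; rewrite exchange_big /= -sumrN; apply: eq_bigr => i _.
  rewrite -sumrN; apply: eq_bigr => l _.
  by rewrite anti scalerN mulrC.
move=> j _; rewrite aE [RHS](eq_bigl predT); last by move=> l; rewrite inE.
under [LHS]eq_bigr do rewrite bE ?inE // scaler_sumr.
under [RHS]eq_bigr do rewrite mulr_suml.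
rewrite [RHS]exchange_big /=; apply: eq_bigr => i _.
rewrite [LHS](eq_bigl predT); last by move=> l; rewrite inE.
under [RHS]eq_bigr do rewrite mulr_suml.
rewrite [RHS]exchange_big /=; apply: eq_bigr => l _.
rewrite gP mulr_sumr scaler_sumr; apply: eq_bigr => k _.
by rewrite -scalerAr scalerA -scalerAl.
Qed.

End ChangeOfGenerators.
End Koszul.

(** * Forms of degree n and n - 1 *)

Section TopForms.
Variables (K : numClosedFieldType) (n : nat).
Local Notation R := {mpoly K[n]}.
Local Notation form := (diff_form K n).
Variable f : R.
Hypothesis n_ge2 : (2 <= n)%N.

Local Notation df := (fun i => f^`M(i)).

Definition sgn1 (i : 'I_n) (S : {set 'I_n}) : R := (-1) ^+ inversions [set i] S.

Lemma sgn1K i S x : sgn1 i S * (sgn1 i S * x) = x.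
Proof. by rewrite mulrA -expr2 sqrr_sign mul1r. Qed.

Lemma inversions1 (i : 'I_n) (S : {set 'I_n}) : inversions [set i] S = #|[set k in S | (k < i)%N]|.
Proof.
rewrite -(card_imset (f := fun k : 'I_n => (i, k))); last by move=> x y [].
apply: eq_card => -[x y]; rewrite !inE /=.
apply/and3P/imsetP => [[/eqP -> yS lt_yi]|[k]].
  by exists y; rewrite ?inE ?yS.
by rewrite inE => /andP[kS lt_k] [-> ->].
Qed.

Lemma inversions1U (i k : 'I_n) (S : {set 'I_n}) : k \notin S ->
  inversions [set i] (k |: S) = ((k < i) + inversions [set i] S)%N.
Proof.
move=> kS; rewrite !inversions1; case: (boolP (k < i)%N) => lt_ki.
  have -> : [set x in k |: S | (x < i)%N] = k |: [set x in S | (x < i)%N].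
    by apply/setP => x; rewrite !inE; case: eqP => // ->; rewrite lt_ki.
  by rewrite cardsU1 inE (negPf kS).
rewrite add0n; apply: eq_card => x; rewrite !inE; case: eqP => // ->.
by rewrite (negPf lt_ki) !andbF.
Qed.

Lemma wedge_df (v : form) S :
  wedge (total_diff f) v S = \sum_(i in S) sgn1 i (S :\ i) * (f^`M(i) * v (S :\ i)).
Proof.
have tdE A : total_diff f A = \sum_i f^`M(i) * (A == [set i])%:R.
  by rewrite sum_ffunE; apply: eq_bigr => i _; rewrite !ffunE.
rewrite ffunE; under eq_bigr do rewrite tdE mulr_suml mulr_sumr.
rewrite exchange_big /= [RHS]big_mkcond /=; apply: eq_bigr => i _.
rewrite -sub1set; case: ifP => iS; last first.
  apply: big1 => A AS; case: eqP => [AE|_]; last by rewrite mulr0 mul0r mulr0.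
  by rewrite -AE AS in iS.
rewrite (bigD1 [set i]) //= big1 ?addr0 ?eqxx ?mulr1 // => A /andP[_ /negPf ->].
by rewrite mulr0 mul0r mulr0.
Qed.

Lemma Omega_wedge_df j (v : form) : Omega j v -> Omega j.+1 (wedge (total_diff f) v).
Proof.
move=> hv S cS; rewrite wedge_df big1 // => i iS.
rewrite hv ?mulr0 //; apply: contra cS => /eqP <-.
by rewrite [X in X == _](cardsD1 i) iS.
Qed.

Lemma card_setT_eq (S : {set 'I_n}) : (#|S| == n) = (S == setT).
Proof.
apply/eqP/eqP => [cS|->]; last by rewrite cardsT card_ord.
by apply/eqP; rewrite eqEcard subsetT cardsT card_ord cS leqnn.
Qed.

Lemma Omega_top (w : form) S : Omega n w -> S != setT -> w S = 0.
Proof. by move=> Ow; rewrite -card_setT_eq; apply: Ow. Qed.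

Lemma compl1P (S : {set 'I_n}) : #|S| = n.-1 -> exists i, S = ~: [set i].
Proof.
move=> cS; have /cards1P[i iE] : #|~: S| == 1%N.
  by rewrite cardsCs setCK card_ord cS; apply/eqP; lia.
by exists i; rewrite -iE setCK.
Qed.

Lemma card_compl1 (i : 'I_n) : #|~: [set i]| = n.-1.
Proof. by rewrite cardsC1 card_ord. Qed.

Lemma setT_D1 (i : 'I_n) : setT :\ i = ~: [set i].
Proof. by rewrite setTD. Qed.

Definition of_coefs (a : 'I_n -> R) : form :=
  [ffun S => \sum_i (if S == ~: [set i] then sgn1 i S * a i else 0)].

Lemma of_coefs_compl a i : of_coefs a (~: [set i]) = sgn1 i (~: [set i]) * a i.
Proof.
rewrite ffunE (bigD1 i) //= eqxx big1 ?addr0 // => k ki.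
by case: eqP => // /setC_inj/set1_inj ik; rewrite ik eqxx in ki.
Qed.

Lemma Omega_of_coefs a : Omega n.-1 (of_coefs a).
Proof.
move=> S cS; rewrite ffunE big1 // => i _; case: eqP => // SE.
by rewrite SE card_compl1 eqxx in cS.
Qed.

(** ** n-forms *)

Definition volume (a : R) : form := [ffun S => if S == setT then a else 0].

Lemma volume_setT a : volume a setT = a. Proof. by rewrite ffunE eqxx. Qed.

Lemma Omega_volume a : Omega n (volume a).
Proof. by move=> S; rewrite card_setT_eq ffunE => /negPf ->. Qed.

Lemma linear_top : linear (fun w : form => w setT).
Proof. by move=> c w w'; rewrite !ffunE. Qed.

Lemma df_Omega_top (w : form) : Omega n w ->
  df_Omega f n.-1 w <-> gen df setT (w setT).
Proof.
move=> Ow; split=> [[v Ov ->]|[c cE]].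
  rewrite wedge_df; apply: ideal_sum => [|i iS]; first exact: ideal_gen.
  rewrite mulrCA mulrC; apply: idealM; [exact: ideal_gen|exact: (gen_mem df)].
exists (of_coefs c); first exact: Omega_of_coefs.
apply/ffunP => S; case: (eqVneq S setT) => [->|ST].
  rewrite cE wedge_df; apply: eq_bigr => i _; rewrite setT_D1 of_coefs_compl.
  by rewrite mulrCA sgn1K mulrC.
rewrite (Omega_top Ow ST); have := Omega_wedge_df (Omega_of_coefs c).
by rewrite prednK; [move=> h; rewrite (Omega_top h ST) | lia].
Qed.

Lemma form_homog_top k (w : form) : Omega n w ->
  form_homog k w <-> forall m, m \in msupp (w setT) -> (mdeg m + n)%N%:Z = k.
Proof.
move=> Ow; split=> [h m /h|h S m]; first by rewrite cardsT card_ord.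
case: (eqVneq S setT) => [->|ST]; first by rewrite cardsT card_ord; apply: h.
by rewrite (Omega_top Ow ST) msupp0.
Qed.

Lemma form_homog_top_ge j (w : form) : Omega n w ->
  form_homog (j%:Z + n%:Z) w <-> w setT \is j.-homog.
Proof.
move=> Ow; apply: iff_trans (form_homog_top _ Ow) _; split=> [h|/dhomogP h m /h /= ->].
  by apply/dhomogP => m /h /=; lia.
by [].
Qed.

Lemma form_homog_top_lt k (w : form) : Omega n w -> k < n%:Z ->
  form_homog k w -> w setT = 0.
Proof.
move=> Ow lt_k /(form_homog_top _ Ow) h; apply/eqP; rewrite -msupp_eq0.
case E: msupp => [//|m r]; have := h m; rewrite E mem_head => /(_ isT).
by move: lt_k; lia.
Qed.

Lemma Omega_fmul (g : R) (w : form) j : Omega j w -> Omega j (fmul g w).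
Proof. by move=> Ow S /Ow; rewrite ffunE => ->; rewrite mulr0. Qed.

Lemma M_torsion_top (w : form) : Omega n w ->
  M_torsion f w <-> exists j0, forall j, (j0 <= j)%N ->
    forall g : 'I_j -> R, (forall i, irrelevant (g i)) ->
      gen df setT (\prod_i g i * w setT).
Proof.
move=> Ow; have E g : df_Omega f n.-1 (fmul g w) <-> gen df setT (g * w setT).
  apply: iff_trans (df_Omega_top (Omega_fmul g Ow)) _; by rewrite ffunE.
split=> [[_ [j0 h]]|[j0 h]]; last split=> //; exists j0 => j le_j g hg; apply/E; exact: h.
Qed.

(** ** (n - 1)-forms *)

(** With these signs, df /\ w is the sum of the coefs w i * f^`M(i). *)
Definition coefs (w : form) : 'I_n -> R :=
  fun i => sgn1 i (~: [set i]) * w (~: [set i]).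

Lemma linear_coefs i : linear (coefs ^~ i).
Proof. by move=> c w w'; rewrite /coefs !ffunE mulrDr -scalerAr. Qed.

Lemma of_coefsK a : coefs (of_coefs a) =1 a.
Proof. by move=> i; rewrite /coefs of_coefs_compl sgn1K. Qed.

Lemma wedge_df_eq0 (w : form) : Omega n.-1 w ->
  wedge (total_diff f) w = 0 <-> \sum_i coefs w i * f^`M(i) = 0.
Proof.
move=> Ow; have E : wedge (total_diff f) w setT = \sum_i coefs w i * f^`M(i).
  rewrite wedge_df (eq_bigl predT); last by move=> i; rewrite inE.
  by apply: eq_bigr => i _; rewrite setT_D1 /coefs mulrCA mulrC.
rewrite -E; split=> [->|E0]; first by rewrite ffunE.
apply/ffunP => S; rewrite [RHS]ffunE; case: (eqVneq S setT) => [->//|ST].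
have := Omega_wedge_df Ow; rewrite prednK; last by lia.
by move/Omega_top; apply.
Qed.

(** The sign relating dx_i /\ dx_j /\ dx_S, S the complement of i and j, to the
    volume form. *)
Definition sgn2 (i j : 'I_n) : R :=
  sgn1 i (~: [set i]) * sgn1 j (~: [set i] :\ j).

Lemma compl2E (i j : 'I_n) : ~: [set i] :\ j = ~: [set i; j].
Proof. by apply/setP => k; rewrite !inE negb_or andbC. Qed.

Lemma sgn2_anti i j : i != j -> sgn2 i j = - sgn2 j i.
Proof.
move=> ij; rewrite /sgn2 !compl2E [in RHS]setUC.
have ci : ~: [set i] = j |: ~: [set i; j].
  apply/setP => k; rewrite !inE negb_or; case: (eqVneq k j) => [->|_].
    by rewrite eq_sym ij.
  by rewrite andbT.
have cj : ~: [set j] = i |: ~: [set i; j].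
  apply/setP => k; rewrite !inE negb_or; by case: (eqVneq k i) => [->|_] //=.
rewrite /sgn1 ci inversions1U ?inE ?eqxx ?orbT //.
rewrite cj inversions1U ?inE ?eqxx //.
have [lt_ij|lt_ji|E] := ltngtP i j; last by move/eqP: ij; case; apply: val_inj.
  by rewrite add0n add1n exprS mulN1r mulNr opprK mulrC.
by rewrite add0n add1n exprS mulN1r mulNr mulrC.
Qed.

Lemma wedge_df_coefs (v : form) i :
  coefs (wedge (total_diff f) v) i =
  \sum_(j | j != i) sgn2 i j * v (~: [set i; j]) * f^`M(j).
Proof.
rewrite /coefs wedge_df mulr_sumr; apply: eq_big => [j|j _]; first by rewrite !inE.
by rewrite compl2E /sgn2 compl2E -!mulrA (mulrC (v _)).
Qed.

Lemma set2_inj (i j k m : 'I_n) : i != j -> [set i; j] = [set k; m] ->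
  (k = i /\ m = j) \/ (k = j /\ m = i).
Proof.
move=> ij E.
have : i \in [set k; m] by rewrite -E !inE eqxx.
have : j \in [set k; m] by rewrite -E !inE eqxx orbT.
rewrite !inE => /pred2P[jk|jm] /pred2P[ik|im].
- by rewrite jk ik eqxx in ij.
- by right.
- by left.
- by rewrite jm im eqxx in ij.
Qed.

(** An (n-2)-form has one coefficient for each pair i < j; with the signs sgn2 it
    becomes an antisymmetric matrix. *)
Lemma df_Omega_koszul (w : form) : Omega n.-1 w ->
  df_Omega f n.-2 w <-> koszul df (coefs w).
Proof.
move=> Ow; split=> [[v Ov ->]|[b [anti bE]]].
  exists (fun i j => if j == i then 0 else sgn2 i j * v (~: [set i; j])); split.
    move=> i j; rewrite eq_sym; case: eqP => [_|/eqP ji]; first by rewrite oppr0.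
    by rewrite sgn2_anti // setUC mulNr.
  move=> i _; rewrite wedge_df_coefs [RHS](bigD1 i) ?inE //= eqxx mul0r add0r.
  by apply: eq_big => [j|j /negPf ->]; first by rewrite inE.
(* v on the complement of {i, j} is b i j up to sign; by antisymmetry the order
   of the pair does not matter *)
pose v : form := [ffun S =>
  if [pick p : 'I_n * 'I_n | (p.1 != p.2) && (S == ~: [set p.1; p.2])] is Some p
  then sgn2 p.1 p.2 * b p.1 p.2 else 0].
have vE i j : i != j -> v (~: [set i; j]) = sgn2 i j * b i j.
  move=> ij; rewrite ffunE; case: pickP => [[k m] /=|/(_ (i, j))]; last first.
    by rewrite /= ij eqxx.
  case/andP => km /eqP/setC_inj/(set2_inj ij)[[-> ->]|[-> ->]] //.
  by rewrite sgn2_anti 1?eq_sym // anti mulrNN.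
have Ov : Omega n.-2 v.
  move=> S cS; rewrite ffunE; case: pickP => [[i j] /= /andP[ij /eqP SE]|//].
  move: cS; rewrite SE cardsCs setCK card_ord cards2 ij; case/eqP; lia.
exists v => //; apply/ffunP => S.
have Odv : Omega n.-1 (wedge (total_diff f) v).
  by have := Omega_wedge_df Ov; rewrite prednK //; lia.
case: (eqVneq #|S| n.-1) => [/compl1P[i ->]|cS]; last by rewrite Ow ?Odv.
suff : coefs w i = coefs (wedge (total_diff f) v) i.
  by move=> E; rewrite -[LHS](sgn1K i (~: [set i])) -[RHS](sgn1K i (~: [set i])) -!/(coefs _ i) E.
rewrite wedge_df_coefs (bE i) ?inE // (bigD1 i) ?inE //= antisym_diag // mul0r add0r.
apply: eq_big => [j|j /andP[_ ji]]; first by rewrite inE.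
have ij : i != j by rewrite eq_sym.
rewrite (vE _ _ ij) [sgn2 i j * _]mulrA.
rewrite [X in X * _ * _](_ : _ = 1) ?mul1r //.
by rewrite /sgn2 mulrACA -!expr2 !sqrr_sign mul1r.
Qed.

Lemma form_homog_coefs k (w : form) : Omega n.-1 w ->
  form_homog k w <->
  forall i m, m \in msupp (coefs w i) -> (mdeg m + n.-1)%N%:Z = k.
Proof.
move=> Ow; have E i m : (m \in msupp (coefs w i)) = (m \in msupp (w (~: [set i]))).
  rewrite /coefs /sgn1 -signr_odd; case: (odd _); rewrite ?mulN1r ?mul1r //.
  by rewrite (perm_mem (msuppN _)).
split=> [h i m|h S m mS]; first by rewrite E => /h; rewrite card_compl1.
case: (eqVneq #|S| n.-1) => [cS|cS]; last by rewrite Ow ?msupp0 in mS.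
have [i SE] := compl1P cS; rewrite cS; apply: (h i); by rewrite E -SE.
Qed.

Lemma form_homog_coefs_ge j (w : form) : Omega n.-1 w ->
  form_homog (j%:Z + n.-1%:Z) w <-> forall i, coefs w i \is j.-homog.
Proof.
move=> Ow; apply: iff_trans (form_homog_coefs _ Ow) _; split=> [h i|h i m].
  by apply/dhomogP => m /h /=; lia.
by move/(dhomog_mf (h i)) => /= ->.
Qed.

Lemma form_homog_coefs_lt k (w : form) : Omega n.-1 w -> k < n.-1%:Z ->
  form_homog k w -> coefs w =1 fun=> 0.
Proof.
move=> Ow lt_k /(form_homog_coefs _ Ow) h i; apply/eqP; rewrite -msupp_eq0.
case E: msupp => [//|m r]; have := h i m; rewrite E mem_head => /(_ isT).
by move: lt_k; lia.
Qed.

End TopForms.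

(** * The polynomial 1 + t + ... + t^(e-1) *)

Section GeometricSum.
Variable e : nat.
Hypothesis e_gt0 : (0 < e)%N.

Definition geom : {poly int} := \poly_(i < e) 1.

Definition ci_hilb (k : nat) : nat -> nat := iter k (widen e) (fun j => (j == 0)%N : nat).

Lemma ci_hilbE k j : (ci_hilb k j)%:Z = (geom ^+ k)`_j.
Proof.
elim: k j => [|k IH] j; first by rewrite expr0 coef1; case: j.
rewrite exprSr coefM /= /widen -natz natr_sum big_mkcond /=.
apply: eq_bigr => i _; rewrite natz IH coef_poly.
have -> : (j - i < e)%N = (j < i + e)%N by have := ltn_ord i; lia.
by case: ifP => _; rewrite ?mulr1 ?mulr0.
Qed.

Lemma size_geom : size geom = e. Proof. exact: size_poly_eq. Qed.

Lemma ci_hilb_top k : ci_hilb k (k * e.-1) = 1%N.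
Proof.
have -> : (k * e.-1)%N = (size (geom ^+ k)).-1 by rewrite size_exp size_geom mulnC.
apply/eqP; rewrite -(eqr_nat int) !natz ci_hilbE -lead_coefE lead_coef_exp.
by rewrite lead_coef_poly ?expr1n.
Qed.

Lemma ci_hilb_big k j : (k * e.-1 < j)%N -> ci_hilb k j = 0%N.
Proof.
move=> lt_j; apply/eqP; rewrite -(eqr_nat int) !natz ci_hilbE nth_default //.
by apply: leq_trans (leqSpred _) _; rewrite size_exp size_geom mulnC.
Qed.

Lemma ci_hilb0 k : ci_hilb k 0 = 1%N.
Proof.
apply/eqP; rewrite -(eqr_nat int) !natz ci_hilbE; elim: k => [|k IH].
  by rewrite expr0 coef1.
by rewrite exprS coefM big_ord1 subn0 (eqP IH) coef_poly e_gt0.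
Qed.

Lemma gammaE n j : gamma n e.+1 (j%:Z + n%:Z) = (ci_hilb n j)%:Z.
Proof.
rewrite -PoszD /gamma /gamma_poly ci_hilbE.
have -> : 'X^(e.+1) - 'X = ('X * geom) * ('X - 1) :> {poly int}.
  rewrite exprS -[X in _ - X = _]mulr1 -mulrBr subrX1 -mulrA [geom * _]mulrC.
  congr (_ * (_ * _)); rewrite /geom poly_def; apply: eq_bigr => i _.
  by rewrite scale1r.
rewrite exprMn Pdiv.IdomainMonic.mulpK; last by rewrite monic_exp // monicXsubC.
by rewrite exprMn coefXnM ltnNge leq_addl addnK.
Qed.

End GeometricSum.

(** * Transfer to differential forms *)

Section NodalForms.
Variables (K : numClosedFieldType) (n : nat) (f : {mpoly K[n]}) (e : nat).
Local Notation R := {mpoly K[n]}.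
Local Notation form := (diff_form K n).
Local Notation df := (fun i => f^`M(i)).
Variables (u : 'I_n -> R) (i0 : 'I_n) (h : nat -> nat) (T : nat).
Variables (P : 'M[K]_n) (g : 'I_n -> R).
Variables (s : nat) (z : 'I_s -> 'rV[K]_n) (y : 'I_s -> R).

Local Notation l := (u i0).
Local Notation G := (gen u (~: [set i0])).
Local Notation J := (adjoin G (g i0)).

Hypotheses (n_ge2 : (2 <= n)%N) (s_gt0 : (0 < s)%N).
Hypothesis f_homog : f \is e.+1.-homog.
Hypothesis ci : complete_intersection u (fun i => if i == i0 then 1%N else e) h T.
Hypothesis hT : h T = 1%N.
Hypothesis unitP : P \in unitmx.
Hypothesis gP : forall i, g i = \sum_j P i j *: f^`M(j).
Hypothesis ug : forall i, i != i0 -> u i = g i.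
Hypothesis lz : forall i, ev (z i) l = 1.
Hypothesis Jz : forall q i, J q -> ev (z i) q = 0.
Hypothesis Jred : forall a, (forall i, ev (z i) a = 0) -> adjoin J (l - 1) a.
Hypothesis y_homog : forall i, y i \is 1.-homog.
Hypothesis yz : forall i k, ev (z k) (y i) = (i == k)%:R.

Let g_homog i : g i \is e.-homog.
Proof.
by rewrite gP; apply: rpred_sum => j _; apply: rpredZ; apply: (homog_mderiv j f_homog).
Qed.

Let gen_ug a : gen u (~: [set i0]) a <-> gen g (~: [set i0]) a.
Proof.
have E (c : 'I_n -> R) :
    \sum_(i in ~: [set i0]) c i * u i = \sum_(i in ~: [set i0]) c i * g i.
  by apply: eq_bigr => i; rewrite !inE => /ug ->.
by split=> -[c ->]; exists c; rewrite E.
Qed.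

Lemma jacobian_idealP a : gen df setT a <-> J a.
Proof.
apply: iff_trans (_ : gen g setT a <-> J a); last first.
  apply: iff_trans (gen_setT g i0 a) _; apply: adjoin_ext => b.
  by apply: iff_sym; apply: gen_ug.
split; apply: gen_sub; try exact: ideal_gen.
  move=> j _; rewrite (gens_inv unitP gP j); apply: ideal_sum => [|i _].
    exact: ideal_gen.
  by apply: idealZ; [apply: ideal_gen | apply: (gen_mem g)].
move=> i _; rewrite gP; apply: ideal_sum => [|j _]; first exact: ideal_gen.
by apply: idealZ; [apply: ideal_gen | apply: (gen_mem df)].
Qed.

Let J_homog : homog_ideal J.
Proof. exact: homog_ideal_adjoin (homog_ideal_gen _ (ci_homog ci)) (g_homog i0). Qed.

Let torsionP (w : form) j : Omega n w -> w setT \is j.-homog ->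
  M_torsion f w <-> at_nodes z (w setT).
Proof.
move=> Ow hw; have [idJ _] := J_homog.
apply: (iff_trans (M_torsion_top f n_ge2 Ow)).
apply: (iff_trans _ (iff_sym (at_nodesP ci (g_homog i0) lz Jz Jred hw))).
have hl : l \is 1.-homog by have := ci_homog ci i0; rewrite eqxx.
split=> [[j0 tors]|[N JN]].
  have l_irr : irrelevant l.
    exists (fun k => (l@_U_(k))%:MP); rewrite {1}(linear_formE hl).
    by apply: eq_bigr => k _; rewrite mul_mpolyC.
  have /jacobian_idealP := tors j0 (leqnn _) (fun=> l) (fun=> l_irr).
  by rewrite prodr_const card_ord; exists j0.
have [j0 tors] := torsion_of_power ci JN.
by exists j0 => k le_k c hc; apply/jacobian_idealP; apply: tors.
Qed.

Lemma subspace_top_forms k : subspace (fun w : form => Omega n w /\ form_homog k w).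
Proof.
split=> [|c w w' [Ow hw] [Ow' hw']].
  split=> [S _|S m]; first by rewrite ffunE.
  by rewrite ffunE msupp0.
split=> [S cS|S m]; first by rewrite !ffunE Ow // Ow' // scaler0 addr0.
rewrite !ffunE => /msuppD_le; rewrite mem_cat => /orP[/msuppZ_le|]; [exact: hw|exact: hw'].
Qed.

Lemma dim_M''_nodal j : dim_M'' f (j%:Z + n%:Z) (reduced_dim s j).
Proof.
apply: (@quot_dim_comap _ _ _ (fun w : form => w setT) _ _ _
  (@homog_of K n j) (at_nodes z)) (quot_dim_at_nodes s_gt0 ci lz y_homog yz j).
- exact: linear_top.
- exact: subspace_top_forms.
- by apply: subspace_ideal; apply: ideal_at_nodes.
- by move=> w [Ow /(form_homog_top_ge n_ge2 _ Ow)].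
- by move=> w [Ow /(form_homog_top_ge n_ge2 _ Ow)]; apply: torsionP.
move=> a ha; exists (volume a); last by rewrite volume_setT subrr; apply: (ideal0 (ideal_at_nodes z)).
split; first exact: Omega_volume.
by apply/(form_homog_top_ge n_ge2 _ (Omega_volume a)); rewrite volume_setT.
Qed.

Lemma dim_M'_nodal j m :
  quot_dim (homog_in j (at_nodes z)) J m -> dim_M' f (j%:Z + n%:Z) m.
Proof.
have [idJ _] := J_homog.
pose A (w : form) := Omega n w /\ homog_in j (at_nodes z) (w setT).
have sA : subspace A.
  have sN := subspace_homog_in j (ideal_at_nodes z).
  split=> [|c w w' [Ow hw] [Ow' hw']].
    by split=> [S _|]; rewrite ffunE //; case: sN.
  split=> [S cS|]; first by rewrite !ffunE Ow // Ow' // scaler0 addr0.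
  by rewrite !ffunE; case: sN => _; apply.
move=> q; apply: (quot_dim_eq (A := A) (B := df_Omega f n.-1)) => //.
  move=> w; split=> [[Ow [hw zw]]|[[Ow tw] hw]].
    by split; [apply/(torsionP Ow hw) | apply/(form_homog_top_ge n_ge2 _ Ow)].
  have hw' : w setT \is j.-homog by apply/(form_homog_top_ge n_ge2 _ Ow).
  by split=> //; split=> //; apply/(torsionP Ow hw').
apply: (@quot_dim_comap _ _ _ (fun w : form => w setT) _ _ _
  (homog_in j (at_nodes z)) J) q => //.
- exact: linear_top.
- exact: subspace_ideal.
- by move=> w [].
- move=> w [Ow _]; apply: (iff_trans (df_Omega_top f n_ge2 Ow)).
  exact: jacobian_idealP.
move=> a ha; exists (volume a); last by rewrite volume_setT subrr; apply: ideal0.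
by split; [apply: Omega_volume | rewrite volume_setT].
Qed.

Let koszulP (a : 'I_n -> R) : \sum_i a i * g i = 0 -> koszul g a <-> G (a i0).
Proof.
move=> sum0; split=> [/(koszul_gen i0)/gen_ug //|Ga].
have setTE : [set: 'I_n] = i0 |: ~: [set i0] by rewrite setUCr.
rewrite /koszul setTE; apply: koszul_step.
- by rewrite !inE eqxx.
- move=> a' sum0'; have [|b [anti bE]] := @koszul_regular K n (~: [set i0]) u a' (ci_regular ci).
    by rewrite -[RHS]sum0'; apply: eq_bigr => i; rewrite !inE => /ug ->.
  exists b; split=> // i iT; rewrite (bE i iT); apply: eq_bigr => j.
  by rewrite !inE => /ug ->.
- by rewrite -setTE -[RHS]sum0; apply: eq_bigl => i; rewrite inE.
exact/gen_ug.
Qed.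

(** The first Koszul homology of the partial derivatives is identified with
    (G : g i0) / G by the last coefficient with respect to the generators g. *)
Lemma dim_N_nodal j :
  dim_N e.+1 f (j%:Z + n.-1%:Z + e.+1%:Z) (koszul_dim T s j).
Proof.
have idG : ideal G by apply: ideal_gen.
have idW := ideal_quot (g i0) idG.
pose A (w : form) := [/\ Omega n.-1 w, \sum_i coefs w i * f^`M(i) = 0
  & forall i, coefs w i \is j.-homog].
have sA : subspace A.
  split=> [|c w w' [Ow kw hw] [Ow' kw' hw']].
    have c0 i : coefs (0 : form) i = 0 by rewrite /coefs ffunE mulr0.
    split=> [S _|//|i]; first by rewrite ffunE.
      by rewrite big1 // => i _; rewrite c0 mul0r.
    by rewrite c0 rpred0.
  split=> [S cS||i].
  - by rewrite !ffunE Ow // Ow' // scaler0 addr0.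
  - under eq_bigr do rewrite linear_coefs mulrDl -scalerAl.
    by rewrite big_split /= -scaler_sumr kw kw' scaler0 addr0.
  - by rewrite linear_coefs rpredD ?rpredZ.
apply: (quot_dim_eq (A := A) (B := df_Omega f n.-2)) => //.
  rewrite addrK => w; split=> [[Ow kw hw]|[Ow kw hw]].
    by split=> //; [apply/(wedge_df_eq0 f n_ge2 Ow) | apply/(form_homog_coefs_ge n_ge2 _ Ow)].
  by split=> //; [apply/(wedge_df_eq0 f n_ge2 Ow) | apply/(form_homog_coefs_ge n_ge2 _ Ow)].
have dimW := quot_dim_koszul s_gt0 ci hT (g_homog i0) lz Jz Jred y_homog yz j.
apply: (@quot_dim_comap _ _ _ (fun w : form => new_coefs P (coefs w) i0) _ _ _
  (homog_in j (fun a : R => G (g i0 * a))) G) dimW => //.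
- move=> c w w'; rewrite /new_coefs scaler_sumr -big_split; apply: eq_bigr => i _ /=.
  by rewrite linear_coefs scalerDr !scalerA mulrC.
- exact: subspace_ideal.
- move=> w [Ow kw hw]; split.
    by apply: rpred_sum => i _; apply: rpredZ; apply: hw.
  have := sum_new_coefs unitP gP (coefs w); rewrite kw (bigD1 i0) //= mulrC.
  move/eqP; rewrite addr_eq0 => /eqP ->; apply/(idealN idG)/gen_ug.
  exists (new_coefs P (coefs w)); by apply: eq_bigl => i; rewrite !inE.
- move=> w [Ow kw hw]; apply: (iff_trans (df_Omega_koszul f n_ge2 Ow)).
  apply: (iff_trans (koszul_new unitP gP _)); apply: koszulP.
  by rewrite (sum_new_coefs unitP gP).
move=> a [ha [c cE]].
pose v i := if i == i0 then a else - hpart j (c i).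
have v0 : \sum_i v i * g i = 0.
  have hga : g i0 * a \is (j + e).-homog by rewrite addnC; apply: dhomogM.
  rewrite (bigD1 i0) //= {1}/v eqxx mulrC -(pihomog_dE hga) cE raddf_sum /=.
  apply/eqP; rewrite addr_eq0 -sumrN; apply/eqP; apply: eq_big => [i|i].
    by rewrite !inE.
  rewrite !inE => ii0; have hu := g_homog i; rewrite -ug // in hu *.
  by rewrite (hpartM _ _ hu) leq_addl addnK /v (negPf ii0) mulNr opprK.
pose w := of_coefs (old_coefs P v).
have cw i : coefs w i = old_coefs P v i by apply: of_coefsK.
have nw i : new_coefs P (coefs w) i = v i.
  rewrite -[RHS](new_coefsK unitP v); apply: eq_bigr => k _; by rewrite cw.
exists w; last by rewrite nw /v eqxx subrr; apply: ideal0.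
split=> [||i].
- exact: Omega_of_coefs.
- rewrite -(sum_new_coefs unitP gP) -[RHS]v0.
  by apply: eq_bigr => i _; rewrite nw.
- rewrite cw; apply: rpred_sum => k _; apply: rpredZ; rewrite /v.
  by case: ifP => _ //; rewrite rpredN pihomogP.
Qed.

Lemma dim_M''_low k : k < n%:Z -> dim_M'' f k 0.
Proof.
move=> lt_k; apply/quot_dim0 => w [Ow /(form_homog_top_lt n_ge2 Ow lt_k) w0].
apply/(M_torsion_top f n_ge2 Ow); exists 0%N => j _ c _; rewrite w0 mulr0.
by apply: ideal0; apply: ideal_gen.
Qed.

Lemma dim_M'_low k : k < n%:Z -> dim_M' f k 0.
Proof.
move=> lt_k; apply/quot_dim0 => w [[Ow _] /(form_homog_top_lt n_ge2 Ow lt_k) w0].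
apply/(df_Omega_top f n_ge2 Ow); rewrite w0; by apply: ideal0; apply: ideal_gen.
Qed.

Lemma dim_N_low d k : k - d%:Z < n.-1%:Z -> dim_N d f k 0.
Proof.
move=> lt_k; apply/quot_dim0 => w [Ow _ hw].
have c0 := form_homog_coefs_lt n_ge2 Ow lt_k hw.
apply/(df_Omega_koszul f n_ge2 Ow); exists (fun _ _ => 0); split=> [*|i _].
  by rewrite oppr0.
by rewrite c0 big1 // => j _; rewrite mul0r.
Qed.

End NodalForms.

(** * Hypersurfaces with independent ordinary double points *)

Section NodalHypersurface.
Variables (K : numClosedFieldType) (n d : nat) (f : {mpoly K[n]}).
Variables (s : nat) (z : 'I_s -> 'rV[K]_n).
Local Notation R := {mpoly K[n]}.
Local Notation df := (fun i => f^`M(i)).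

Hypotheses (n_ge2 : (2 <= n)%N) (s_gt0 : (0 < s)%N).
Hypothesis f_homog : f \is d.-homog.
Hypothesis z_sing : sing_points f z.
Hypothesis z_odp : forall i, ordinary_double_point f (z i).

(** Otherwise the Hessian matrices vanish, while n >= 2. *)
Lemma nodal_degree_ge2 : (2 <= d)%N.
Proof.
rewrite ltnNge; apply/negP => d_le1.
have [zs _ _] := z_sing; have [v0 _ _] := zs (Ordinal s_gt0).
have /rV0Pn[k vk] := v0; have [_ [_]] := z_odp vk.
set H := \matrix_(i, j) _ => unitH.
have H0 : H = 0.
  apply/matrixP => i j; rewrite !mxE !mderiv_dehom.
  by rewrite (mderiv2_homog_small _ _ f_homog d_le1) /dehom comp_mpoly0 ev0.
have n1 : (0 < n.-1)%N by lia.
have := mulVmx unitH; rewrite H0 mulmx0 => /matrixP/(_ (Ordinal n1) (Ordinal n1)).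
by rewrite !mxE eqxx => /esym/eqP; rewrite oner_eq0.
Qed.

Lemma dual_linear_forms : row_free (\matrix_(i < s) z i) -> exists y : 'I_s -> R,
  (forall i, y i \is 1.-homog) /\ forall i k, ev (z k) (y i) = (i == k)%:R.
Proof.
case/row_freeP => B ZB.
exists (fun i => \sum_k B k i *: 'X_k); split=> [i|i k].
  by apply: rpred_sum => k _; apply: rpredZ; rewrite dhomogX /= mdeg1.
have /matrixP/(_ k i) := ZB; rewrite !mxE eq_sym => <-.
rewrite ev_sum; apply: eq_bigr => j _.
by rewrite evZ evXU !mxE mulrC.
Qed.

Lemma singular_on_line (p : 'rV[K]_n) : p != 0 ->
  (forall i, ev p f^`M(i) = 0) -> exists i c, p = c *: z i.
Proof.
move=> p0 Sp; have [_ _] := z_sing; apply; split=> //.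
have := ev_euler p f_homog; rewrite big1 => [/esym/eqP|i _]; last by rewrite Sp mulr0.
rewrite mulf_eq0 pnatr_eq0 => /orP[|/eqP //].
by have := nodal_degree_ge2; lia.
Qed.

Variable l : R.
Hypotheses (l_homog : l \is 1.-homog) (lz : forall i, ev (z i) l = 1).

Lemma no_singularity_at_infinity (p : 'rV[K]_n) : p != 0 -> ev p l = 0 ->
  exists i, ev p f^`M(i) != 0.
Proof.
move=> p0 lp; apply/existsP; apply: contraNT p0; rewrite negb_exists => /forallP Sp.
apply/negPn/negP => p0; have [|i [c pE]] := singular_on_line p0.
  by move=> k; have := Sp k; rewrite negbK => /eqP.
move: lp; rewrite pE (ev_scale _ _ l_homog) lz expr1 mulr1 => c0.
by rewrite pE c0 scale0r eqxx in p0.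
Qed.

(** The partial derivatives and l - 1 have injective Jacobian matrix at z i: a
    vector killed by the Hessian matrix is a multiple of z i, where l is 1. *)
Lemma node_reduced (Q : R -> Prop) i : ideal Q ->
  (forall j, Q f^`M(j)) -> Q (l - 1) ->
  exists2 delta, ev (z i) delta != 0 &
    forall k, Q (delta * ('X_k - (z i 0 k)%:MP)).
Proof.
move=> idQ Qf Ql; have [zs _ _] := z_sing; have [v0 fv Sv] := zs i.
pose q (j : 'I_(n + 1)) := if split j is inl a then f^`M(a) else l - 1.
pose D := \matrix_(j, k) ev (z i) (q j)^`M(k).
have /row_freeP[L DL] : row_free D^T.
  apply: inj_row_free => v vD.
  have Dv j : \sum_k ev (z i) (q j)^`M(k) * v 0 k = 0.
    transitivity ((v *m D^T) 0 j); last by rewrite vD mxE.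
    by rewrite mxE; apply: eq_bigr => k _; rewrite !mxE mulrC.
  have [|c vE] := odp_hessian f_homog (zs i) (@z_odp i) (x := fun k => v 0 k).
    move=> k; have := Dv (lshift 1 k); rewrite /q.
    by rewrite (unsplitK (inl k : 'I_n + 'I_1)).
  have := Dv (rshift n ord0); rewrite /q (unsplitK (inr ord0 : 'I_n + 'I_1)).
  have dl k : (l - 1)^`M(k) = l^`M(k) by rewrite mderivB -mpolyC1 mderivC subr0.
  under eq_bigr do rewrite dl vE mulrCA (mulrC (ev _ _)).
  rewrite -mulr_sumr (ev_euler _ l_homog) lz !mulr1 => c0.
  by apply/rowP => k; rewrite vE c0 mul0r mxE.
apply: (local_maximal_ideal (g := q) (L := L^T)) => //.
- by move=> j; rewrite /q; case: split.
- move=> j; rewrite /q; case: split => [k|_]; first exact: Sv.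
  by rewrite evB lz ev1 subrr.
- by rewrite -/D -[D]trmxK -trmx_mul DL trmx1.
Qed.

End NodalHypersurface.

Lemma moment_matrix_unit (K : fieldType) n (t : 'I_n -> K) : injective t ->
  \matrix_(i < n, j < n) t i ^+ j \in unitmx.
Proof.
move=> inj_t; rewrite -unitmx_tr unitmxE.
have -> : (\matrix_(i < n, j < n) t i ^+ j)^T = Vandermonde n (\row_i t i).
  by apply/matrixP => i j; rewrite !mxE.
rewrite det_Vandermonde unitfE; apply/prodf_neq0 => i _.
apply/prodf_neq0 => j lt_ij; rewrite !mxE subr_eq0.
by apply: contraTneq lt_ij => /inj_t ->; rewrite ltnn.
Qed.

(** In degree j the Jacobian algebra has dimension ci_hilb e n j, the coefficient
    of gamma, plus the dimension of Koszul homology in degree j - e; removing the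
    reduced part leaves the torsion. The three terms cancel unless 0 < j < n (e - 1). *)
Lemma torsion_dim_value n e s j m : (2 <= n)%N -> (0 < e)%N -> (0 < s)%N ->
  let h := ci_hilb e n.-1 in let T := (n.-1 * e.-1)%N in
  ((e <= j)%N -> (koszul_dim T s (j - e) <= hilb_sum h (j - e))%N) ->
  jacobian_dim e h T s j = (reduced_dim s j + m)%N ->
  (T = 0%N -> (s <= 1)%N) ->
  m%:Z = if (0 < j)%N && (j < n * e.-1)%N then (ci_hilb e n j)%:Z - s%:Z else 0.
Proof.
move=> n2 e0 s0 h T le_k jE T0.
have nE : n = n.-1.+1 by lia.
have AE : (n * e.-1 = T + e.-1)%N by rewrite /T {1}nE mulSn addnC.
have T_ge : (e.-1 <= T)%N by rewrite /T leq_pmull //; lia.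
have QE : ci_hilb e n = widen e h by rewrite nE.
have {jE} : (ci_hilb e n j + (if e <= j then koszul_dim T s (j - e) else 0) =
             reduced_dim s j + m)%N.
  rewrite -jE QE /jacobian_dim {1}/hilb_sum (sum_widen e); case: ifP => [le_ej|_].
    by rewrite -/(hilb_sum h _); have := le_k le_ej; lia.
  by rewrite subn0 !addn0.
case: (posnP j) => [->|j0].
  by rewrite ci_hilb0 // leqn0 eqn0Ngt e0 /reduced_dim /=; lia.
rewrite /reduced_dim -[j == 0%N]negbK -lt0n j0 /= /koszul_dim.
have := ci_hilb_big e0 (k := n) (j := j); have := ci_hilb_top e0 n.
move: AE; set A := (n * e.-1)%N; clearbody A T => AE top big.
case: (ltngtP j A) => [lt_j|gt_j|jA] /=.
- case: (leqP e j) => [le_ej|_]; last by lia.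
  by have -> : ((j - e).+1 < T)%N; lia.
- rewrite (big gt_j).
  have -> : (e <= j)%N by lia.
  have -> : ((j - e).+1 < T)%N = false by lia.
  by have -> : ((j - e).+1 == T) = false; lia.
- rewrite jA top AE.
  have -> : (e <= T + e.-1)%N by lia.
  have -> : ((T + e.-1 - e).+1 < T)%N = false by lia.
  by have -> : ((T + e.-1 - e).+1 == T); lia.
Qed.

Theorem nodal_dimensions (K : numClosedFieldType) (n d : nat) (f : {mpoly K[n]})
    (s : nat) (z : 'I_s -> 'rV[K]_n) :
  (2 <= n)%N -> f \is d.-homog -> sing_points f z ->
  (forall i, ordinary_double_point f (z i)) ->
  row_free (\matrix_(i < s) z i) -> (1 <= s)%N ->
  forall k : int,
    [/\ dim_M'' f k (if k < n%:Z then 0%N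
                     else if k == n%:Z then 1%N else s),
        dim_N d f k (if k < n%:Z * (d%:Z - 1) then 0%N
                     else if k == n%:Z * (d%:Z - 1) then (s - 1)%N else s)
      & exists2 m : nat, dim_M' f k m &
          m%:Z = if (n%:Z < k) && (k < n%:Z * (d%:Z - 1))
                 then gamma n d k - s%:Z else 0].
Proof.
move=> n_ge2 f_homog z_sing z_odp z_free s_gt0.
have d_ge2 := nodal_degree_ge2 n_ge2 s_gt0 f_homog z_sing z_odp.
have [e dE] : exists e, d = e.+1 by exists d.-1; lia.
subst d; have e_gt0 : (0 < e)%N := d_ge2.
have [y [y_homog yz]] := dual_linear_forms z_free.
pose l := \sum_i y i.
have l_homog : l \is 1.-homog by apply: rpred_sum => i _; apply: y_homog.
have lz i : ev (z i) l = 1.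
  rewrite ev_sum (bigD1 i) //= big1 => [|k ki]; rewrite yz; last by rewrite (negPf ki).
  by rewrite eqxx addr0.
have l_neq0 : l != 0.
  by apply/eqP => l0; have /esym/eqP := lz (Ordinal s_gt0); rewrite l0 ev0 oner_eq0.
have f1_homog i : f^`M(i) \is e.-homog by apply: (homog_mderiv i f_homog).
have [i0 [t [u [inj_t ul ut ci]]]] := ci_generic e_gt0 f1_homog l_homog l_neq0
  (no_singularity_at_infinity n_ge2 s_gt0 f_homog z_sing z_odp l_homog lz).
have {}ci : complete_intersection u (fun i => if i == i0 then 1%N else e)
   (ci_hilb e n.-1) (n.-1 * e.-1) by [].
pose P := \matrix_(i < n, j < n) t i ^+ j.
have unitP : P \in unitmx := moment_matrix_unit inj_t.
pose g i := moment_comb (fun j => f^`M(j)) (t i).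
have gP i : g i = \sum_j P i j *: f^`M(j).
  by apply: eq_bigr => j _; rewrite mxE.
have ug i : i != i0 -> u i = g i by apply: ut.
have ulz i : ev (z i) (u i0) = 1 by rewrite ul.
pose G := gen u (~: [set i0]); pose J := adjoin G (g i0).
have idJ : ideal J by apply: ideal_adjoin; apply: ideal_gen.
have JP := jacobian_idealP unitP gP ug.
have Jf i : J f^`M(i) by apply/JP; apply: (gen_mem (fun i => f^`M(i))).
have [zs _ _] := z_sing.
have Jz q i : J q -> ev (z i) q = 0.
  move/JP => Jq; have [_ _ Sz] := zs i.
  by apply: (gen_sub (ideal_vanish (z i)) _ Jq) => j _; apply: Sz.
have Jred a : (forall i, ev (z i) a = 0) -> adjoin J (u i0 - 1) a.
  pose Q := adjoin J (u i0 - 1).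
  have idQ : ideal Q by apply: ideal_adjoin.
  have idQ0 : ideal (adjoin G (u i0 - 1)) by apply: ideal_adjoin; apply: ideal_gen.
  have [D dimQ] : exists D, quot_dim (fun=> True) Q D.
    have hG : homog_ideal G := homog_ideal_gen _ (ci_homog ci).
    have hl : u i0 \is 1.-homog by rewrite ul.
    have nzl : nzd G (u i0) by apply: (ci_regular ci); rewrite !inE eqxx.
    have hB := hilbert_ext (gen_setT u i0) (ci_hilbert ci).
    have dimQ0 := quot_dim_dehomog hG hl hB (ci_top ci) nzl (leqnn _).
    have [||||| D [m [qD _ _]]] := quot_dim_split (A := fun=> True) (B := Q)
      _ _ _ _ _ dimQ0; try by [].
    - exact: subspace_ideal.
    - exact: subspace_ideal.
    - by move=> x _ [b Gb]; exists b; apply: adjoinS.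
    by exists D.
  have Ql : Q (l - 1) by rewrite -ul -[_ - _]mul1r; apply: adjoinv.
  apply: (reduced_points (z := z) idQ dimQ).
  - move=> q i [b Jb]; have := Jz _ i Jb.
    by rewrite evB evM evB ulz ev1 subrr mulr0 subr0.
  - move=> p Qp.
    have lp : ev p l = 1.
      by apply/eqP; rewrite -subr_eq0 -[X in _ - X](ev1 p) -evB; apply/eqP/Qp.
    have p0 : p != 0.
      apply/eqP => p0; move: lp; rewrite p0 -(scale0r (0 : 'rV[K]_n)).
      rewrite (ev_scale _ _ l_homog) expr1 mul0r => /esym/eqP.
      by rewrite oner_eq0.
    have [|i [c pE]] := singular_on_line n_ge2 s_gt0 f_homog z_sing z_odp p0.
      by move=> i; apply: Qp; apply: adjoinS.
    exists i; move: lp; rewrite pE (ev_scale _ _ l_homog) lz expr1 mulr1 => ->.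
    by rewrite scale1r.
  - move=> i; apply: (node_reduced f_homog z_sing z_odp l_homog lz) => // j.
    exact: adjoinS.
have hT := ci_hilb_top e_gt0 n.-1.
have g0_homog : g i0 \is e.-homog.
  by apply: rpred_sum => j _; apply: rpredZ.
have s_le1 := nodes_le1 s_gt0 ci hT g0_homog ulz Jz Jred yz.
have dM'' := dim_M''_nodal n_ge2 s_gt0 f_homog ci unitP gP ug ulz Jz Jred y_homog yz.
have dM' := dim_M'_nodal n_ge2 f_homog ci unitP gP ug ulz Jz Jred.
have dN := dim_N_nodal n_ge2 s_gt0 f_homog ci hT unitP gP ug ulz Jz Jred y_homog yz.
set T := (n.-1 * e.-1)%N in hT s_le1 dN *.
have top : n%:Z * (e.+1%:Z - 1) = T%:Z + n%:Z + e%:Z - 1.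
  have -> : n%:Z * (e.+1%:Z - 1) = (n * e)%N%:Z by rewrite PoszM; congr (_ * _); lia.
  have -> : (n * e = T + n + e - 1)%N.
    rewrite /T; case: (n) n_ge2 => // n' _; case: (e) e_gt0 => // e' _ /=.
    by rewrite !mulSn !mulnS; lia.
  by lia.
move=> k; rewrite top; split.
- case: ltP => [lt_kn|le_nk].
    exact: dim_M''_low.
  have [j kE] : exists j : nat, k = j%:Z + n%:Z by exists (absz (k - n%:Z)%R); lia.
  have := dM'' j; rewrite -kE /reduced_dim.
  by congr (quot_dim _ _ (if _ then _ else _)); apply/eqP/eqP; lia.
- case: (ltP (k - e.+1%:Z) n.-1%:Z) => [lt_k|le_k].
    have := dim_N_low f n_ge2 lt_k; congr dim_N.
    case: ltP => [//|le_Tk]; have T0 : T = 0%N by lia.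
    have -> : k = T%:Z + n%:Z + e%:Z - 1 by lia.
    by rewrite eqxx; have := s_le1 T0; lia.
  have [j kE] : exists j : nat, k = j%:Z + n.-1%:Z + e.+1%:Z.
    by exists (absz (k - e.+1%:Z - n.-1%:Z)%R); lia.
  have := dN j; rewrite -kE /koszul_dim.
  congr (dim_N _ _ _ (if _ then _ else if _ then _ else _)); first by lia.
  by apply/eqP/eqP; lia.
case: (ltP k n%:Z) => [lt_k|le_nk].
  exists 0%N; first exact: dim_M'_low.
  by rewrite ltNge ltW.
have [j kE] : exists j : nat, k = j%:Z + n%:Z by exists (absz (k - n%:Z)%R); lia.
have [m qm mE] := quot_dim_torsion s_gt0 ci hT g0_homog ulz Jz Jred y_homog yz j.
exists m; first by rewrite kE; apply: dM'.
have [_ le_k] := quot_dim_jacobian s_gt0 ci hT g0_homog ulz Jz Jred y_homog yz j.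
have le_k' : (e <= j)%N -> (koszul_dim T s (j - e) <= hilb_sum (ci_hilb e n.-1) (j - e))%N.
  by move/le_k/andP => [].
rewrite (torsion_dim_value n_ge2 e_gt0 s_gt0 le_k' mE s_le1) kE gammaE //.
have AE : (n * e.-1 = T + e.-1)%N.
  by rewrite /T -{1}(prednK (ltnW n_ge2)) mulSn addnC.
rewrite AE; congr (if _ then _ else _); lia.
Qed.

Theorem proposition1 (R : realType) (n d : nat) (f : {mpoly R[i][n]})
    (tau s : nat) (z : 'I_s -> 'rV[R[i]]_n)
    (n_ge2 : (2 <= n)%N)
    (f_homog : f \is d.-homog)
    (dim_sing : zdim_le (Sing f) 1)
    (f_vars : ~ poly_of_fewer_variables f)
    (z_sing : sing_points f z)
    (z_odp : forall i, ordinary_double_point f (z i))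
    (z_free : row_free (\matrix_(i < s) z i))
    (tau_def : total_tjurina f tau)
    (tau_ge1 : (1 <= tau)%N) :
  forall k : int,
    [/\ dim_M'' f k (if k < n%:Z then 0%N
                     else if k == n%:Z then 1%N else tau),
        dim_N d f k (if k < n%:Z * (d%:Z - 1) then 0%N
                     else if k == n%:Z * (d%:Z - 1) then (tau - 1)%N else tau)
      & exists2 m : nat, dim_M' f k m &
          m%:Z = if (n%:Z < k) && (k < n%:Z * (d%:Z - 1))
                 then gamma n d k - tau%:Z else 0].
Proof.
have tauE := total_tjurina_odp z_sing z_odp tau_def; subst tau.
exact: (nodal_dimensions n_ge2 f_homog z_sing z_odp z_free tau_ge1).
Qed.
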